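(* Let $\mathbb F\in\{\mathbb R,\mathbb C\}$, $d\ge 3$, and let $\mathcal S\in \mathrm S^d\mathbb F^n\setminus\{0\}$. Let $f(\mathbf x)=\mathcal S\times\otimes^d\mathbf x$ be the associated nonzero homogeneous polynomial of degree $d$ in $n$ variables over $\mathbb F$, and let $\mathbf F=\frac1d\nabla f$. Denote $$\mathrm{fix}(\mathbf F)=\{\mathbf x\in\mathbb C^n:\ \mathbf F(\mathbf x)=\mathbf x\},\qquad \mathrm{afix}(\mathbf F)=\{\mathbf x\in\mathbb C^n:\ \mathbf F(\mathbf x)=\overline{\mathbf x}\}.$$ Let $\omega_{d-2}=e^{\pi \mathrm i/(d-2)}$ (so $\omega_{d-2}^{d-2}=-1$). When $f$ has real coefficients, denote $$\mathrm{fix}_{\mathbb R}(\mathbf F)=\begin{cases}\mathrm{fix}(\mathbf F)\cap\mathbb R^n & \text{if } d \text{ is odd},\\ \big(\mathrm{fix}(\mathbf F)\cup\overline{\omega_{d-2}}\,\mathrm{fix}(\mathbf F)\big)\cap\mathbb R^n & \text{if } d\text{ is even}.\end{cases}$$ (1) Assume $\mathbb F=\mathbb R$. Then $$\|\mathcal S\|_{\sigma,\mathbb R}=\|f\|_{\sigma,\mathbb R}=\max\Big\{\frac{|f(\mathbf x)|}{\|\mathbf x\|^d}:\ \mathbf x\in\mathrm{fix}_{\mathbb R}(\mathbf F)\setminus\{\mathbf 0\}\Big\}.$$ (2) Let $\mathbb F=\mathbb C$. Let $\overline{\mathbf F}:\mathbb C^n\to\mathbb C^n$ be the polynomial map $\overline{\mathbf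 F}(\mathbf x)=\overline{\mathbf F(\overline{\mathbf x})}$ and let $\mathbf H=\overline{\mathbf F}\circ\mathbf F$. Then the set $\mathrm{fix}(\mathbf H)=\{\mathbf x\in\mathbb C^n:\mathbf H(\mathbf x)=\mathbf x\}$ contains $\mathrm{afix}(\mathbf F)$. Furthermore, $\mathbf x$ is a fixed point of $\mathbf H$ if and only if there is $\mathbf y\in\mathbb C^n$ such that $(\mathbf x,\mathbf y)\in\mathbb C^n\times\mathbb C^n$ is a solution of the system $$\mathbf F(\mathbf x)-\mathbf y=\mathbf 0,\qquad \overline{\mathbf F}(\mathbf y)-\mathbf x=\mathbf 0.$$ Moreover $$\|\mathcal S\|_{\sigma}=\|f\|_\sigma=\max\Big\{\frac{|f(\mathbf x)|}{\|\mathbf x\|^d}:\ \mathbf x\in\mathrm{fix}(\mathbf H)\setminus\{\mathbf 0\}\Big\}.$$ (3) Assume that $\mathcal S\in\mathrm S^d\mathbb C^n$ is nonsingular. Then $\mathrm{fix}(\mathbf F)$ and $\mathrm{fix}(\mathbf H)$ have cardinalities $(d-1)^n$ and $(d-1)^{2n}$ respectively, counted with multiplicities. The origin $\mathbf x=\mathbf 0$ is a fixed point of $\mathbf F$ and of $\mathbf H$ of multiplicity one. Let $\mathbf x\in\mathrm{fix}(\mathbf F)\setminus\{\mathbf 0\}$, $\mathbf y\in\mathrm{fix}(\mathbf H)\setminus\{\mathbf 0\}$ and $\phi,\psi\in\mathbb C$. Then $\phi\mathbf x\in\mathrm{fix}(\mathbf F)\setminus\{\mathbf 0\}$ if and only if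 $\phi^{d-2}=1$, and $\psi\mathbf y\in\mathrm{fix}(\mathbf H)\setminus\{\mathbf 0\}$ if and only if $\psi^{(d-1)^2-1}=1$.
   Context: $\mathrm S^d\mathbb F^n$ is the space of symmetric $d$-mode tensors $\mathcal S=[\mathcal S_{i_1,\ldots,i_d}]$, $i_1,\dots,i_d\in\{1,\dots,n\}$, with entries in $\mathbb F$ (invariant under all permutations of indices). For $\mathbf x\in\mathbb C^n$, $\mathcal S\times\otimes^d\mathbf x=\sum_{i_1,\ldots,i_d}\mathcal S_{i_1,\ldots,i_d}x_{i_1}\cdots x_{i_d}$, and $\mathcal S\times\otimes^{d-1}\mathbf x$ is the vector with $i$-th coordinate $\sum_{i_2,\ldots,i_d}\mathcal S_{i,i_2,\ldots,i_d}x_{i_2}\cdots x_{i_d}$; one has $\mathbf F(\mathbf x)=\mathcal S\times\otimes^{d-1}\mathbf x=\frac1d\nabla f(\mathbf x)$. $\|\mathbf x\|$ is the Euclidean (Hermitian) norm. The spectral norm is $\|\mathcal S\|_{\sigma,\mathbb F}=\max\{|\sum \mathcal S_{i_1,\dots,i_d}x_{i_1,1}\cdots x_{i_d,d}|:\ \mathbf x_k=(x_{1,k},\dots,x_{n,k})^\top\in\mathbb F^n,\ \|\mathbf x_k\|=1\}$, which by Banach's theorem equals $\max\{|\mathcal S\times\otimes^d\mathbf x|:\mathbf x\in\mathbb F^n,\|\mathbf x\|=1\}$; for a homogeneous polynomial $f$ one sets $\|f\|_{\sigma,\mathbb F}=\max\{|f(\mathbf x)|:\mathbf x\in\mathbb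 F^n,\|\mathbf x\|=1\}$. The subscript $\sigma$ without a field means $\mathbb F=\mathbb C$. $\mathcal S\in\mathrm S^d\mathbb C^n$ is nonsingular if $\mathcal S\times\otimes^{d-1}\mathbf x=\mathbf 0$ with $\mathbf x\in\mathbb C^n$ implies $\mathbf x=\mathbf 0$. The multiplicity of a fixed point of a polynomial map $\mathbf G:\mathbb C^n\to\mathbb C^n$ is its multiplicity as an isolated zero of the system $\mathbf G(\mathbf x)-\mathbf x=\mathbf 0$. *)

(* Defs.v *)
From HB Require Import structures.
From mathcomp Require Import all_boot all_order all_algebra all_fingroup.
From mathcomp Require Import mpoly complex.
From mathcomp Require Import classical_sets reals trigo.

Set Implicit Arguments.
Unset Strict Implicit.
Unset Printing Implicit Defensive.

Import Order.TTheory GRing.Theory Num.Theory.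

Local Open Scope classical_set_scope.
Local Open Scope ring_scope.

Inductive scalar_field := RealScalars | ComplexScalars.

(* Real tensors and vectors are viewed as complex ones with real entries. *)
Definition scalars (R : realType) (K : scalar_field) : {pred R[i]} :=
  if K is RealScalars then [pred z : R[i] | z \is Num.real] else predT.

Definition hnorm (R : realType) (n : nat) (x : 'rV[R[i]]_n) : R :=
  Num.sqrt (\sum_i Normc.normc (x 0 i) ^+ 2).

Definition conj_vec (R : realType) (n : nat) (x : 'rV[R[i]]_n) : 'rV[R[i]]_n :=
  map_mx Num.conj x.

Definition is_max (R : realType) (A : set R) (m : R) : Prop :=
  A m /\ ubound A m.

Section Tensors.
Context (R : realType) (d n : nat).

Definition tensor := {ffun d.-tuple 'I_n -> R[i]}.

Definition symmetric_tensor (K : scalar_field) (S : tensor) : Prop :=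
  (forall t, S t \in scalars K) /\
  (forall (s : 'S_d) (t : d.-tuple 'I_n), S [tuple tnth t (s k) | k < d] = S t).

Definition multilinear_form (S : tensor) (x : 'I_d -> 'rV[R[i]]_n) : R[i] :=
  \sum_(t : d.-tuple 'I_n) S t * \prod_(k < d) x k 0 (tnth t k).

(* The i-th coordinate sums over the index tuples whose first index is i. *)
Definition contract_all_but_one (S : tensor) (x : 'rV[R[i]]_n) : 'rV[R[i]]_n :=
  \row_i \sum_(t : d.-tuple 'I_n | ohead t == Some i)
            S t * \prod_(j <- behead t) x 0 j.

Definition tensor_poly (S : tensor) : {mpoly R[i][n]} :=
  \sum_(t : d.-tuple 'I_n) S t *: \prod_(j <- t) 'X_j.

Definition scaled_gradient (S : tensor) (x : 'rV[R[i]]_n) : 'rV[R[i]]_n :=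
  \row_i (d%:R^-1 * ((tensor_poly S)^`M(i)).@[x 0]).

Definition nonsingular_tensor (S : tensor) : Prop :=
  forall x : 'rV[R[i]]_n, contract_all_but_one S x = 0 -> x = 0.

Definition is_tensor_spectral_norm (K : scalar_field) (S : tensor) : R -> Prop :=
  is_max [set Normc.normc (multilinear_form S x) | x in
           [set x : 'I_d -> 'rV[R[i]]_n |
             forall k, x k \is a mxOver (scalars K) /\ hnorm (x k) = 1]].

End Tensors.

Definition is_poly_spectral_norm (R : realType) (n : nat) (K : scalar_field)
    (f : {mpoly R[i][n]}) : R -> Prop :=
  is_max [set Normc.normc f.@[x 0] | x in
           [set x : 'rV[R[i]]_n |
             x \is a mxOver (scalars K) /\ hnorm x = 1]].

Section FixedPoints.
Context (R : realType) (n : nat).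
Implicit Types (G : 'rV[R[i]]_n -> 'rV[R[i]]_n) (A : set 'rV[R[i]]_n).

Definition fix_set G : set 'rV[R[i]]_n := [set x | G x = x].

Definition afix_set G : set 'rV[R[i]]_n := [set x | G x = conj_vec x].

Definition conj_map G : 'rV[R[i]]_n -> 'rV[R[i]]_n :=
  fun x => conj_vec (G (conj_vec x)).

Definition omega (m : nat) : R[i] :=
  Complex (cos (pi / m%:R)) (sin (pi / m%:R)).

Definition real_fix_set (d : nat) G : set 'rV[R[i]]_n :=
  (if odd d then fix_set G
   else fix_set G `|` [set (omega (d - 2))^* *: z | z in fix_set G])
  `&` [set x | x \is a mxOver (scalars RealScalars)].

Definition ratios (d : nat) (f : {mpoly R[i][n]}) A : set R :=
  [set Normc.normc f.@[x 0] / hnorm x ^+ d | x in A `\ 0].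

End FixedPoints.

Section Multiplicity.
Context (R : realType) (n : nat).
Local Notation Frac := {fraction {mpoly R[i][n]}}.
Local Notation "x %:F" := (@FracField.tofrac {mpoly R[i][n]} x).

(* The local ring of C^n at p: fractions regular at p. *)
Definition local_ring (p : 'rV[R[i]]_n) : set Frac :=
  [set r | exists h s : {mpoly R[i][n]}, s.@[p 0] != 0 /\ r = h%:F / s%:F].

Definition local_ideal (g : 'I_n -> {mpoly R[i][n]}) (p : 'rV[R[i]]_n) :
    set Frac :=
  [set r | exists a : 'I_n -> Frac,
     (forall i, local_ring p (a i)) /\ r = \sum_i a i * (g i)%:F].

(* k is the dimension over C of the local ring at p modulo the ideal generated
   by g: the family b induces a basis of the quotient.  This dimension is finite
   and positive exactly when p is an isolated zero of g. *)
Definition has_zero_multiplicity (g : 'I_n -> {mpoly R[i][n]})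
    (p : 'rV[R[i]]_n) (k : nat) : Prop :=
  exists b : 'I_k -> Frac,
    (forall j, local_ring p (b j)) /\
    (forall r, local_ring p r ->
       exists! c : 'rV[R[i]]_k,
         local_ideal g p (r - \sum_j ((c 0 j)%:MP)%:F * b j)).

(* The polynomials P representing G are unique, the field R[i] being infinite. *)
Definition has_fixpoint_multiplicity (G : 'rV[R[i]]_n -> 'rV[R[i]]_n)
    (p : 'rV[R[i]]_n) (k : nat) : Prop :=
  exists P : 'I_n -> {mpoly R[i][n]},
    (forall x, G x = \row_i (P i).@[x 0]) /\
    has_zero_multiplicity (fun i => P i - 'X_i) p k.

Definition fix_card_with_multiplicity (G : 'rV[R[i]]_n -> 'rV[R[i]]_n)
    (N : nat) : Prop :=
  exists (s : seq 'rV[R[i]]_n) (mu : 'rV[R[i]]_n -> nat),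
    [/\ uniq s,
        forall x, fix_set G x <-> x \in s,
        forall x, x \in s -> has_fixpoint_multiplicity G x (mu x) &
        (\sum_(x <- s) mu x)%N = N].

End Multiplicity.

(* Main.v *)
(* A symmetric multilinear form attains its maximum M over tuples of unit vectors on a
   diagonal tuple (z, ..., z) (Banach).  As the linear form w |-> S(w, z, ..., z) then has
   norm M and attains it at z, it is M e^{i t} <w, z>, so F(z) is a multiple of conj z, and
   rescaling z produces the required fixed points; all other ratios are at most M.

   The fixed points of F and H are the zeros of g_i = h_i - x_i, with h_1, ..., h_n forms of
   degree D >= 2 in n variables without common zero other than 0.  Let G_i be the
   homogenization of g_i by a variable x_0.  Starting from the regular sequence
   x_1^D, ..., x_n^D, x_0, each x_i^D is exchanged for a linear combination of the G_j which
   does not vanish at the finitely many points where the other terms are 0 and x_i^D is 1;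
   such an exchange preserves regularity and the dimension of the quotient.  Thus x_0 is
   regular modulo (G_1, ..., G_n), and P[x_0]/(G, x_0) and P[x_0]/(G, x_0 - 1) = P/(g) both
   have dimension D^n.  Idempotents split P/(g) into the local rings at the zeros.  At the
   origin h = A x with A(0) = 0, and Cramer's rule for (A - 1) x = g puts all x_j in the
   ideal of the g_i in the local ring. *)

Require Import Defs.
From mathcomp Require Import all_boot all_order all_algebra.
From mathcomp Require Import fingroup perm.
From mathcomp Require Import mpoly complex zify ring.
From mathcomp Require Import boolp classical_sets reals.
From mathcomp Require Import topology normedtype derive trigo.

Set Implicit Arguments.
Unset Strict Implicit.
Unset Printing Implicit Defensive.

Import Order.TTheory GRing.Theory Num.Theory numFieldNormedType.Exports.

Local Open Scope ring_scope.

(** * Dimensions of quotients *)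

(** Homogenization is what makes counting possible: the ideal of the g_i is not graded, while
    dimensions are compared under an exchange through counts in bounded degree. Because D >= 2, the
    linear terms -x_i disappear at x_0 = 0, so the hypothesis on the h_i says that the G_j have no
    common zero at infinity; this is where nonsingularity of the tensor and d >= 3 enter. A single
    G_j may vanish at one of the points met in an exchange, whence the generic combinations;
    regularity of the final sequence then forces their coefficient matrix to be invertible, so that
    the ideal of the G_j is recovered. The dimension survives because, for a form a of degree e
    regular modulo a graded J, the dimension of P/(J, a) is a difference of two values of the
    counting function of J, and a enters only through e. The Nullstellensatz is applied to ideals of
    finite codimension, where each polynomial satisfies an algebraic relation modulo the ideal. On
    the analytic side, solutions of F(x) = conj x solve H(x) = x, and the maximum over the fixed
    points of H is reached at one of them. *)

Section RelativeDimension.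
Context (C : fieldType).

Definition lincomb (V : lmodType C) r (c : 'rV[C]_r) (b : 'I_r -> V) : V :=
  \sum_j c 0 j *: b j.

Definition subspace (V : lmodType C) (W : V -> Prop) :=
  W 0 /\ forall c u v, W u -> W v -> W (c *: u + v).

Definition spans (V : lmodType C) (U W : V -> Prop) r (b : 'I_r -> V) :=
  forall u, U u -> exists c, W (u - lincomb c b).

Definition free_mod (V : lmodType C) (W : V -> Prop) r (b : 'I_r -> V) :=
  forall c, W (lincomb c b) -> c = 0.

(** No quotient type is formed: [b] is a basis of the image of [U] in the quotient by [W]. Stated
    this way, a part of bounded degree can be measured modulo a whole ideal. *)
Definition has_dim (V : lmodType C) (U W : V -> Prop) r :=
  exists b : 'I_r -> V, [/\ forall j, U (b j), spans U W b & free_mod W b].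

Section OneSpace.
Context (V : lmodType C).
Implicit Types (U W Z : V -> Prop).

Lemma subspaceD W u v : subspace W -> W u -> W v -> W (u + v).
Proof. by move=> [_ h] Wu Wv; have := h 1 _ _ Wu Wv; rewrite scale1r. Qed.

Lemma subspaceZ W c u : subspace W -> W u -> W (c *: u).
Proof. by move=> [h0 h] Wu; have := h c _ _ Wu h0; rewrite addr0. Qed.

Lemma subspaceN W u : subspace W -> W u -> W (- u).
Proof. by move=> sW Wu; rewrite -scaleN1r; exact: subspaceZ. Qed.

Lemma subspaceB W u v : subspace W -> W u -> W v -> W (u - v).
Proof. by move=> sW Wu Wv; apply: subspaceD => //; exact: subspaceN. Qed.

Lemma subspace_sum W I (r : seq I) (P : pred I) (F : I -> V) :
  subspace W -> (forall i, P i -> W (F i)) -> W (\sum_(i <- r | P i) F i).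
Proof.
move=> sW WF; elim/big_ind: _ => //; first by case: sW.
by move=> ? ?; exact: subspaceD.
Qed.

Lemma subspace_lincomb W r (c : 'rV_r) b :
  subspace W -> (forall j, W (b j)) -> W (lincomb c b).
Proof. by move=> sW Wb; apply: subspace_sum => // j _; exact: subspaceZ. Qed.

Lemma subspace_subl W u v : subspace W -> W (u - v) -> W v -> W u.
Proof. by move=> sW h Wv; rewrite -(subrK v u); exact: subspaceD. Qed.

Lemma lincombD r (c c' : 'rV_r) (b : 'I_r -> V) :
  lincomb (c + c') b = lincomb c b + lincomb c' b.
Proof. by rewrite -big_split; apply: eq_bigr => j _; rewrite mxE scalerDl. Qed.

Lemma lincombN r (c : 'rV_r) (b : 'I_r -> V) : lincomb (- c) b = - lincomb c b.
Proof. by rewrite -sumrN; apply: eq_bigr => j _; rewrite mxE scaleNr. Qed.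

Lemma lincomb_mulmx r s (c : 'rV_s) (A : 'M_(s, r)) (b : 'I_r -> V) :
  lincomb (c *m A) b = \sum_k c 0 k *: lincomb (row k A) b.
Proof.
rewrite /lincomb; under [RHS]eq_bigr do rewrite scaler_sumr.
rewrite exchange_big; apply: eq_bigr => j _; rewrite mxE scaler_suml.
by apply: eq_bigr => k _; rewrite mxE scalerA.
Qed.

(** If [s > r], the coordinate matrix of [b'] with respect to [b] has more rows than columns, and a
    nonzero row of its left kernel is a relation among the [b'] modulo [W]. *)
Lemma free_le_spanning U W r s (b : 'I_r -> V) (b' : 'I_s -> V) :
  subspace W -> spans U W b -> (forall j, U (b' j)) -> free_mod W b' ->
  (s <= r)%N.
Proof.
move=> sW spb Ub' fb'; rewrite leqNgt; apply/negP => lt_rs.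
have [A hA] := choice (fun k => spb _ (Ub' k)).
pose M := \matrix_k A k.
have kM : kermx M != 0.
  rewrite kermx_eq0 -row_leq_rank -ltnNge.
  by apply: leq_ltn_trans lt_rs; exact: rank_leq_col.
have [i ki] : exists i, row i (kermx M) != 0.
  apply: contrapT => h; move/negP: kM; apply; apply/eqP/row_matrixP => i.
  by rewrite row0; apply: contrapT => /eqP h'; apply: h; exists i.
move/negP: ki; apply; apply/eqP/fb'; set c := row _ _.
apply: (@subspace_subl _ _ (lincomb (c *m M) b)) => //.
  rewrite lincomb_mulmx -sumrB; apply: subspace_sum => // k _.
  by rewrite -scalerBr rowK; exact: subspaceZ.
have -> : c *m M = 0 by rewrite -row_mul mulmx_ker row0.
by rewrite /lincomb big1 => [|j _]; [case: sW|rewrite mxE scale0r].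
Qed.

Lemma has_dim_uniq U W r s :
  subspace W -> has_dim U W r -> has_dim U W s -> r = s.
Proof.
move=> sW [b [Ub sb fb]] [b' [Ub' sb' fb']]; apply/eqP; rewrite eqn_leq.
by rewrite (free_le_spanning sW sb' Ub fb) (free_le_spanning sW sb Ub' fb').
Qed.

Lemma has_dim_spanning U W r (b : 'I_r -> V) :
  subspace W -> (forall j, U (b j)) -> spans U W b -> exists s, has_dim U W s.
Proof.
move=> sW; elim: r b => [|r IH] b Ub sb.
  by exists 0%N, b; split=> // c _; apply/rowP; case.
have [fb|nfb] := pselect (free_mod W b); first by exists r.+1, b.
have [c [Wc /eqP/rV0Pn[j cj]]] : exists c, W (lincomb c b) /\ c <> 0.
  apply: contrapT => h; apply: nfb => c Wc; apply: contrapT => c0.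
  by apply: h; exists c.
apply: (IH (fun k => b (lift j k))) => // u Uu.
have [e We] := sb _ Uu.
(* Subtracting [e 0 j / c 0 j] times the relation [c] cancels the coefficient of [b j], which is
   thereby dropped from the family. *)
exists (\row_k (e 0 (lift j k) - e 0 j / c 0 j * c 0 (lift j k))).
have -> : u - lincomb (\row_k (e 0 (lift j k) - e 0 j / c 0 j * c 0 (lift j k)))
    (fun k => b (lift j k)) = (u - lincomb e b) + (e 0 j / c 0 j) *: lincomb c b.
  rewrite /lincomb !(bigD1_ord j) //= scalerDr scalerA divfK //.
  rewrite opprD !addrA [u - _ - _]addrAC subrK -!addrA; congr (_ + _).
  rewrite scaler_sumr -sumrN -sumrN -big_split; apply: eq_bigr => k _ /=.
  by rewrite mxE scalerBl scalerA opprB addrC.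
by apply: subspaceD => //; exact: subspaceZ.
Qed.

Lemma has_dimD U W Z r s : subspace Z -> (forall v, Z v -> W v) ->
  subspace W -> subspace U -> (forall v, W v -> U v) ->
  has_dim U W r -> has_dim W Z s -> has_dim U Z (r + s).
Proof.
move=> sZ ZW sW sU WU [b [Ub sb fb]] [b' [Wb' sb' fb']].
pose bb (j : 'I_(r + s)) :=
  match fintype.split j with inl k => b k | inr k => b' k end.
have lE c : lincomb c bb = lincomb (lsubmx c) b + lincomb (rsubmx c) b'.
  rewrite /lincomb big_split_ord; congr (_ + _); apply: eq_bigr => k _;
    by rewrite mxE /bb ?(unsplitK (inl k)) ?(unsplitK (inr k)).
exists bb; split.
- by move=> j; rewrite /bb; case: fintype.split => k; [exact: Ub|exact/WU/Wb'].
- move=> u Uu; have [c Wc] := sb _ Uu; have [c' Zc'] := sb' _ Wc.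
  exists (row_mx c c'); rewrite lE row_mxKl row_mxKr.
  by rewrite opprD addrA.
- move=> c; rewrite lE => Zc.
  have lc0 : lsubmx c = 0.
    apply: fb; apply: (@subspace_subl _ _ (- lincomb (rsubmx c) b')) => //.
      by rewrite opprK; exact: ZW.
    by apply: subspaceN => //; exact: subspace_lincomb.
  have rc0 : rsubmx c = 0.
    apply: fb'; move: Zc; rewrite lc0 {1}/lincomb big1 ?add0r // => k _.
    by rewrite mxE scale0r.
  by rewrite -[c]hsubmxK lc0 rc0 row_mx0.
Qed.

Lemma has_dim0 W : subspace W -> has_dim W W 0.
Proof.
move=> sW; exists (fun _ => 0); split=> [[]//|u Wu|c _]; last by apply/rowP; case.
by exists 0; rewrite /lincomb big_ord0 subr0.
Qed.

Lemma has_dim_eq U W U' W' r : (forall v, U v <-> U' v) -> (forall v, W v <-> W' v) ->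
  has_dim U W r -> has_dim U' W' r.
Proof.
move=> eU eW [b [Ub sb fb]]; exists b; split=> [j|u /eU /sb [c]|c /eW /fb//].
  exact/eU.
by move/eW; exists c.
Qed.

End OneSpace.

(** The hypotheses say that [phi] induces an isomorphism from [U] modulo [W] onto [U'] modulo [W'].
    With the identity as [phi] it changes the presentation of one quotient. *)
Lemma has_dim_transport (V V' : lmodType C) (phi : V -> V')
    (U W : V -> Prop) (U' W' : V' -> Prop) r :
  linear phi -> subspace U -> subspace W' ->
  (forall u, U u -> U' (phi u)) -> (forall u, U u -> W' (phi u) <-> W u) ->
  (forall v, U' v -> exists2 u, U u & W' (v - phi u)) ->
  has_dim U W r -> has_dim U' W' r.
Proof.
move=> lphi sU sW' UU' WW' surj [b [Ub sb fb]].
have phi0 : phi 0 = 0.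
  by have /esym/eqP := lphi 1 0 0; rewrite !scale1r !addr0 -subr_eq0 addrK => /eqP.
have phiB u v : phi (u - v) = phi u - phi v.
  by rewrite addrC -scaleN1r lphi scaleN1r addrC.
have lE c : lincomb c (fun j => phi (b j)) = phi (lincomb c b).
  by apply/esym; rewrite /lincomb; elim/big_rec2: _ => // j x y _ <-; rewrite lphi.
exists (fun j => phi (b j)); split=> [j|v U'v|c]; first exact: UU'.
  have [u Uu W'u] := surj _ U'v; have [c Wc] := sb _ Uu; exists c.
  rewrite lE -[v](subrK (phi u)) -addrA -phiB.
  apply: subspaceD => //; apply/WW' => //.
  by apply: subspaceB => //; exact: subspace_lincomb.
by rewrite lE => W'c; apply/fb/WW' => //; exact: subspace_lincomb.
Qed.

End RelativeDimension.

(** * Ideals of finite codimension *)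

Section Ideals.
Context (C : fieldType) (n : nat).
Local Notation P := {mpoly C[n]}.
Implicit Types (I J : P -> Prop) (f g u w : P).

Definition ideal I := [/\ I 0, forall u v, I u -> I v -> I (u + v) &
  forall u v, I v -> I (u * v)].

Definition add_gen I a : P -> Prop := fun f => exists j w, I j /\ f = j + w * a.

Definition whole : P -> Prop := fun _ => True.

(** [msize] is one more than the degree, and 0 at the zero polynomial: these are the polynomials of
    degree strictly below [K]. The same shift occurs in all later bounds. *)
Definition size_le K : P -> Prop := fun f => (msize f <= K)%N.

Definition is_zero I (v : 'rV[C]_n) := forall f, I f -> f.@[v 0] = 0.

(** Finite dimension of the quotient, phrased by a degree bound on representatives because
    inductions on the degree produce it in this form. *)
Definition finite_codim I := exists K, forall f, exists2 f', (msize f' <= K)%N & I (f - f').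

Lemma ideal_mulr I u v : ideal I -> I u -> I (u * v).
Proof. by case=> _ _ h /h; rewrite mulrC. Qed.

Lemma ideal_subspace I : ideal I -> subspace I.
Proof.
move=> [I0 ID IM]; split=> // c u v Iu Iv; apply: ID => //.
by rewrite -mul_mpolyC; exact: IM.
Qed.

Lemma ideal_sub I u v : ideal I -> I u -> I v -> I (u - v).
Proof. by move=> /ideal_subspace; exact: subspaceB. Qed.

Lemma ideal_sum I A (r : seq A) (Q : pred A) (F : A -> P) :
  ideal I -> (forall i, Q i -> I (F i)) -> I (\sum_(i <- r | Q i) F i).
Proof. by move=> /ideal_subspace; exact: subspace_sum. Qed.

Lemma ideal_subl I u v : ideal I -> I (u - v) -> I v -> I u.
Proof. by move=> /ideal_subspace; exact: subspace_subl. Qed.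

Lemma ideal_add_gen I a : ideal I -> ideal (add_gen I a).
Proof.
move=> iI; have [I0 ID IM] := iI; split.
- by exists 0, 0; rewrite mul0r addr0.
- move=> u v [j [w [Ij ->]]] [j' [w' [Ij' ->]]]; exists (j + j'), (w + w').
  by split; [exact: ID|rewrite mulrDl addrACA].
- move=> u v [j [w [Ij ->]]]; exists (u * j), (u * w).
  by split; [exact: IM|rewrite mulrDr mulrA].
Qed.

Lemma sub_add_gen I a f : I f -> add_gen I a f.
Proof. by move=> If; exists f, 0; rewrite mul0r addr0. Qed.

Lemma mem_add_gen I a w : ideal I -> add_gen I a (w * a).
Proof. by case=> I0 _ _; exists 0, w; rewrite add0r. Qed.

Lemma gen_add_gen I a : ideal I -> add_gen I a a.
Proof. by move=> iI; rewrite -[X in add_gen _ _ X]mul1r; exact: mem_add_gen. Qed.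

Lemma ideal_quotient I a : ideal I -> ideal (fun f => I (a * f)).
Proof.
move=> [I0 ID IM]; split; first by rewrite mulr0.
- by move=> u v Iu Iv; rewrite mulrDr; exact: ID.
- by move=> u v Iv; rewrite mulrCA; exact: IM.
Qed.

Lemma add_gen_min I J a f : ideal J -> (forall g, I g -> J g) -> J a ->
  add_gen I a f -> J f.
Proof.
by move=> [_ JD JM] IJ Ja [j [w [Ij ->]]]; apply: JD; [exact: IJ|exact: JM].
Qed.

Lemma subspace_size_le K : subspace (size_le K).
Proof.
split=> [|c u v su sv]; first by rewrite /size_le msize0.
apply: leq_trans (msizeD_le _ _) _; rewrite geq_max sv andbT.
exact: leq_trans (msizeZ_le _ _) su.
Qed.

Lemma has_dim_size_le K W : subspace W -> exists s, has_dim (size_le K) W s.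
Proof.
move=> sW; pose em (j : 'I_#|{: 'X_{1..n < K}}|) : 'X_{1..n < K} := enum_val j.
pose b j : P := 'X_[em j].
apply: (@has_dim_spanning _ _ _ _ _ b) => // [j|f sf].
  by rewrite /size_le /b msizeX; exact: bmdeg.
exists (\row_j f@_(em j)).
suff -> : lincomb (\row_j f@_(em j)) b = f by rewrite subrr; case: sW.
rewrite [RHS](mpolywE sf) /lincomb.
rewrite [RHS](reindex_onto em enum_rank) => [|m _]; last exact: enum_rankK.
by apply: eq_big => j; rewrite /em ?enum_valK ?eqxx // => _; rewrite mxE.
Qed.

Lemma has_dim_whole_size_le K W r : subspace W ->
  (forall f, exists2 f', (msize f' <= K)%N & W (f - f')) ->
  has_dim (size_le K) W r -> has_dim whole W r.
Proof.
move=> sW hK; apply: (@has_dim_transport _ _ _ id) => //.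
- exact: subspace_size_le.
- by move=> f _; have [f'] := hK f; exists f'.
Qed.

Lemma finite_codim_has_dim I : ideal I -> finite_codim I -> exists N, has_dim whole I N.
Proof.
move=> /ideal_subspace sI [K hK]; have [s ds] := has_dim_size_le K sI.
by exists s; exact: has_dim_whole_size_le ds.
Qed.

Lemma has_dim_finite_codim I N : has_dim whole I N -> finite_codim I.
Proof.
move=> [b [_ sb _]]; exists (\max_j msize (b j)) => f.
have [c Ic] := sb f Logic.I; exists (lincomb c b) => //.
apply: leq_trans (msize_sum _ _ _) _; apply/bigmax_leqP => j _.
by apply: leq_trans (msizeZ_le _ _) _; exact: leq_bigmax.
Qed.

Lemma finite_codim_sub I J : (forall f, I f -> J f) -> finite_codim I -> finite_codim J.
Proof. by move=> IJ [K hK]; exists K => f; have [f' ? /IJ] := hK f; exists f'. Qed.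

Lemma horner_algE u (q : {poly C}) : horner_alg u q = \sum_(i < size q) q`_i *: u ^+ i.
Proof.
rewrite -[in LHS](coefK q) poly_def linear_sum; apply: eq_bigr => i _.
by rewrite linearZ /= rmorphXn /= horner_algX mulr_algl.
Qed.

Lemma meval_horner_alg u (q : {poly C}) v : (horner_alg u q).@[v] = q.[u.@[v]].
Proof.
rewrite horner_algE horner_coef rmorph_sum; apply: eq_bigr => i _.
by rewrite /= mevalZ rmorphXn.
Qed.

(** In a quotient of dimension [N] the [N.+1] powers of [u] from exponent 0 to [N] are dependent;
    the relation gives the coefficients of [q]. *)
Lemma finite_codim_algebraic I u : ideal I -> finite_codim I ->
  exists2 q : {poly C}, q != 0 & I (horner_alg u q).
Proof.
move=> iI fI; have [N [b [_ sb _]]] := finite_codim_has_dim iI fI.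
pose p (j : 'I_N.+1) := u ^+ j.
have [|fp] := pselect (free_mod I p).
  by move/(free_le_spanning (ideal_subspace iI) sb (fun=> Logic.I)); rewrite ltnn.
have [c Ic c0] : exists2 c, I (lincomb c p) & c <> 0.
  by apply: contrapT => h; apply: fp => c Ic; apply: contrapT => c0; apply: h; exists c.
exists (rVpoly c).
  by apply/eqP => /(congr1 (@poly_rV _ N.+1)); rewrite rVpolyK linear0.
suff -> : horner_alg u (rVpoly c) = lincomb c p by [].
rewrite /rVpoly poly_def linear_sum /lincomb; apply: eq_bigr => j _.
rewrite insubT // => lt_j; rewrite linearZ /= rmorphXn /= horner_algX mulr_algl.
by congr (c _ _ *: _); exact/val_inj.
Qed.

Lemma mpoly_ring_ind (Q : P -> Prop) : (forall c, Q c%:MP) -> (forall i, Q 'X_i) ->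
  (forall g h, Q g -> Q h -> Q (g + h)) -> (forall g h, Q g -> Q h -> Q (g * h)) ->
  forall f, Q f.
Proof.
move=> QC QX QD QM f; have Q1 : Q 1 by exact: QC 1.
rewrite [f]mpolyE; elim/big_ind: _ => //; first exact: QC 0.
move=> m _; rewrite -mul_mpolyC; apply: (QM) => //; rewrite mpolyXE_id.
have QXn i k : Q ('X_i ^+ k).
  by elim: k => [|k IH]; rewrite ?expr0 // exprS; exact: QM.
by elim/big_ind: _.
Qed.

Lemma meval_congr I (v : 'I_n -> C) f : ideal I ->
  (forall i, I ('X_i - (v i)%:MP)) -> I (f - f.@[v]%:MP).
Proof.
move=> iI Iv; have [I0 ID IM] := iI; elim/mpoly_ring_ind: f => [c|i|g h Ig Ih|g h Ig Ih].
- by rewrite mevalC subrr.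
- by rewrite mevalXU.
- by rewrite mevalD mpolyCD opprD addrACA; exact: ID.
- rewrite mevalM mpolyCM.
  have -> : g * h - g.@[v]%:MP * h.@[v]%:MP =
            g * (h - h.@[v]%:MP) + h.@[v]%:MP * (g - g.@[v]%:MP).
    by rewrite !mulrBr addrA [_ * g]mulrC subrK [_ * h.@[v]%:MP]mulrC.
  by apply: ID; exact: IM.
Qed.

End Ideals.

Arguments whole {C n}.

(** * Zeros of ideals of finite codimension *)

Section Nullstellensatz.
Context (C : closedFieldType) (n : nat).
Local Notation P := {mpoly C[n]}.
Implicit Types (I J : P -> Prop) (f g u w : P).

(** If every [u - r] were invertible modulo [I], so would be the product of the linear factors of a
    polynomial [q] with [q(u)] in [I], and [I] would contain 1. *)
Lemma proper_add_gen I u : ideal I -> finite_codim I -> ~ I 1 ->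
  exists r : C, ~ add_gen I (u - r%:MP) 1.
Proof.
move=> iI fI nI1; have [q q0 Iq] := finite_codim_algebraic u iI fI.
have [_ ID IM] := iI; apply: contrapT => nr.
have {}nr r : add_gen I (u - r%:MP) 1 by apply: contrapT => h; apply: nr; exists r.
have [s qE] := closed_field_poly_normal q.
have Is : I (\prod_(z <- s) (u - z%:MP)).
  move/(IM (lead_coef q)^-1%:MP): Iq; rewrite [X in horner_alg _ X]qE linearZ /=.
  rewrite mul_mpolyC mulr_algl scalerA mulVf ?lead_coef_eq0 // scale1r rmorph_prod /=.
  rewrite [X in I X](_ : _ = \prod_(z <- s) (u - z%:MP)) //; apply: eq_bigr => z _.
  by rewrite rmorphB /= horner_algX horner_algC -mul_mpolyC mulr1.
apply: nI1; elim: s Is {qE} => [|z s IH]; first by rewrite big_nil.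
rewrite big_cons => Is; apply: IH; set p := \prod_(_ <- _) _ in Is *.
have [j [w [Ij one]]] := nr z; have -> : p = j * p + w * ((u - z%:MP) * p).
  by rewrite mulrA -mulrDl -one mul1r.
by apply: ID; [exact: ideal_mulr|exact: IM].
Qed.

(** A zero is built one coordinate at a time: [proper_add_gen] finds a value of the next variable
    that keeps the ideal proper. Once all are fixed, each [f] is congruent to its value at [v],
    which must be 0 for [f] in [I]. *)
Theorem finite_nullstellensatz I : ideal I -> finite_codim I -> ~ I 1 -> exists v, is_zero I v.
Proof.
move=> iI fI nI1.
have step k : (k <= n)%N -> exists J (v : 'rV[C]_n),
    [/\ ideal J, forall f, I f -> J f, ~ J 1 &
        forall i : 'I_n, (i < k)%N -> J ('X_i - (v 0 i)%:MP)].
  elim: k => [_|k IH lt_kn]; first by exists I, 0.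
  have [J [v [iJ IJ nJ1 Jv]]] := IH (ltnW lt_kn).
  have [r nr] := proper_add_gen 'X_(Ordinal lt_kn) iJ (finite_codim_sub IJ fI) nJ1.
  exists (add_gen J ('X_(Ordinal lt_kn) - r%:MP)).
  exists (\row_i if (i : nat) == k then r else v 0 i); split=> //.
  - exact: ideal_add_gen.
  - by move=> f /IJ; exact: sub_add_gen.
  - move=> i; rewrite ltnS leq_eqVlt mxE; case: eqP => /= [ik _|_ lt_ik].
      have -> : i = Ordinal lt_kn by exact: val_inj.
      exact: gen_add_gen.
    by apply: sub_add_gen; exact: Jv.
have [J [v [iJ IJ nJ1 Jv]]] := step n (leqnn n).
exists v => f /IJ Jf; apply: contrapT => /eqP fv0; apply: nJ1.
have Jfv : J (f.@[v 0])%:MP.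
  rewrite -[X in J X](subKr f); apply: ideal_sub => //.
  by apply: meval_congr => // i; exact: Jv.
have [_ _ JM] := iJ; have := JM (f.@[v 0])^-1%:MP _ Jfv.
by rewrite -mpolyCM mulVf.
Qed.

Lemma zero_free_unit I u : ideal I -> finite_codim I ->
  (forall v, is_zero I v -> u.@[v 0] <> 0) -> add_gen I u 1.
Proof.
move=> iI fI h; apply: contrapT => /finite_nullstellensatz[].
- exact: ideal_add_gen.
- by apply: finite_codim_sub fI => f; exact: sub_add_gen.
move=> v zv; apply: (h v); first by move=> f If; apply: zv; exact: sub_add_gen.
by apply: zv; exact: gen_add_gen.
Qed.

(** Factor a relation for [u] as [u ^+ k * q'(u)] with [q'(0)] nonzero. At every zero of [I] the
    value of [q'(u)] is [q'(0)], so [q'(u)] is a unit modulo [I] and [u ^+ k] remains. *)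
Lemma zero_nilpotent I u : ideal I -> finite_codim I ->
  (forall v, is_zero I v -> u.@[v 0] = 0) -> exists k, I (u ^+ k).
Proof.
move=> iI fI h; have [q q0 Iq] := finite_codim_algebraic u iI fI.
have [k [q' q'0 qE]] := multiplicity_XsubC q 0.
rewrite q0 /= in q'0; rewrite subr0 in qE; exists k.
have [j [w [Ij one]]] : add_gen I (horner_alg u q') 1.
  apply: zero_free_unit => // v zv; rewrite meval_horner_alg h //.
  by move/eqP; rewrite -/(root _ _); apply/negP.
have [_ ID IM] := iI; rewrite -[X in I X]mul1r one mulrDl; apply: ID.
  exact: ideal_mulr.
rewrite -mulrA; apply: IM; move: Iq; rewrite qE rmorphM rmorphXn /=.
by rewrite horner_algX.
Qed.

(** The [i]-th coordinates of zeros are roots of a relation for ['X_i], so all zeros lie on a finite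
    grid. *)
Lemma finite_zeros I : ideal I -> finite_codim I ->
  exists2 s : seq 'rV[C]_n, uniq s & forall v, is_zero I v <-> v \in s.
Proof.
move=> iI fI; have [r hr] : exists r : 'I_n -> seq C,
    forall v i, is_zero I v -> v 0 i \in r i.
  suff: forall i, exists r : seq C, forall v, is_zero I v -> v 0 i \in r.
    by move/choice => [r hr]; exists r => v i; exact: hr.
  move=> i; have [q q0 Iq] := finite_codim_algebraic 'X_i iI fI.
  have [r qE] := closed_field_poly_normal q; exists r => v /(_ _ Iq)/eqP.
  rewrite meval_horner_alg mevalXU qE -/(root _ _) rootZ ?lead_coef_eq0 //.
  by rewrite root_prod_XsubC.
pose M := \max_i size (r i).
(* Indices run up to the longest list; the default 0 of [nth] only adds grid points, and the filter
   by [is_zero] discards those that are not zeros. *)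
pose cand := [seq \row_i nth 0 (r i) (g i) | g : {ffun 'I_n -> 'I_M}].
exists (undup [seq v <- cand | `[< is_zero I v >]]); first exact: undup_uniq.
move=> v; rewrite mem_undup mem_filter; split=> [zv|/andP[/asboolP]//].
apply/andP; split; first exact/asboolP.
have lt_M i : (index (v 0%R i) (r i) < M)%N.
  by apply: leq_trans (leq_bigmax i); rewrite index_mem hr.
apply/mapP; exists [ffun i => Ordinal (lt_M i)]; first by rewrite mem_enum.
by apply/rowP => i; rewrite mxE ffunE nth_index // hr.
Qed.

End Nullstellensatz.

(** * Graded counting *)

Section Graded.
Context (C : fieldType) (n : nat).
Local Notation P := {mpoly C[n]}.
Implicit Types (I J : P -> Prop) (f g u w a c z : P).
Local Notation hcomp := (pihomog mdeg).

Definition graded J := forall f, J f -> forall k, J (hcomp k f).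

Definition regular_mod J a := forall z, J (z * a) -> J z.

Lemma size_leP K f : (msize f <= K)%N <-> forall m, m \in msupp f -> (mdeg m < K)%N.
Proof.
split=> [sf m /msize_mdeg_lt mf|h]; first exact: leq_trans sf.
by rewrite mmeasureE; apply/bigmax_leqP_seq => m /h.
Qed.

Lemma size_homog k f : f \is k.-homog -> (msize f <= k.+1)%N.
Proof. by move/dhomogP => h; apply/size_leP => m /h ->. Qed.

Lemma msize_mul_le i j u w : (msize u <= i)%N -> (msize w <= j.+1)%N ->
  (msize (u * w) <= i + j)%N.
Proof.
move=> su sw; have [->|u0] := eqVneq u 0; first by rewrite mul0r msize0.
have [->|w0] := eqVneq w 0; first by rewrite mulr0 msize0.
rewrite msizeM // -ltnS; move: (leq_add su sw); rewrite addnS.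
by case: (_ + _)%N.
Qed.

Lemma msize_sub_le k u w : (msize u <= k)%N -> (msize w <= k)%N -> (msize (u - w) <= k)%N.
Proof. exact: (subspaceB (@subspace_size_le _ _ k)). Qed.

Lemma msize_add_le k u w : (msize u <= k)%N -> (msize w <= k)%N -> (msize (u + w) <= k)%N.
Proof. exact: (subspaceD (@subspace_size_le _ _ k)). Qed.

Lemma hcomp_small k f : (msize f <= k)%N -> hcomp k f = 0.
Proof.
move/size_leP => h; rewrite pihomogE big_seq_cond big_pred0 // => m.
by apply/negP => /andP[/h + /eqP mk]; rewrite mk ltnn.
Qed.

Lemma size_sub_hcomp k f : (msize f <= k.+1)%N -> (msize (f - hcomp k f) <= k)%N.
Proof.
move=> sf; rewrite [X in X - _](pihomog_partitionE sf) big_ord_recr /= addrK.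
apply: (@subspace_sum _ _ (size_le k)) => [|i _]; first exact: subspace_size_le.
rewrite /size_le.
by apply: leq_trans (size_homog (pihomogP _ _ _)) _.
Qed.

Lemma hcomp_mul_homog e a u k : a \is e.-homog ->
  hcomp (k + e) (u * a) = hcomp k u * a.
Proof.
move=> ha; rewrite {1}(pihomog_partitionE (leqnn (msize u))) mulr_suml linear_sum /=.
have [lt_k|le_k] := ltnP k (msize u); last first.
  rewrite hcomp_small // mul0r big1 // => i _.
  apply: (@pihomog_ne0 _ _ _ (i + e)%N); last exact: dhomogM (pihomogP _ _ _) ha.
  by rewrite eqn_add2r neq_ltn (leq_trans (ltn_ord i)).
rewrite (bigD1 (Ordinal lt_k)) //= big1 ?addr0 => [|i ik].
  by rewrite pihomog_dE //; exact: dhomogM (pihomogP _ _ _) ha.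
by apply: (@pihomog_ne0 _ _ _ (i + e)%N); rewrite ?eqn_add2r //;
  exact: dhomogM (pihomogP _ _ _) ha.
Qed.

Lemma hcomp_mul_homog_small e a u k : a \is e.-homog -> (k < e)%N ->
  hcomp k (u * a) = 0.
Proof.
move=> ha lt_ke; rewrite {1}(pihomog_partitionE (leqnn (msize u))) mulr_suml linear_sum /=.
rewrite big1 // => i _.
apply: (@pihomog_ne0 _ _ _ (i + e)%N); last exact: dhomogM (pihomogP _ _ _) ha.
by rewrite neq_ltn; lia.
Qed.

Lemma graded_add_gen J a e : ideal J -> graded J -> a \is e.-homog -> graded (add_gen J a).
Proof.
move=> iJ gJ ha _ [j [w [Jj ->]]] k; rewrite linearD /=.
exists (hcomp k j), (if (e <= k)%N then hcomp (k - e) w else 0); split; first exact: gJ.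
congr (_ + _); case: leqP => [/subnK {1}<-|lt_ke].
  exact: hcomp_mul_homog.
by rewrite mul0r (hcomp_mul_homog_small _ ha).
Qed.

(** The bound on [c - a] makes [a] the part of degree [e] of [c], above all its other terms; lower
    terms of [c] or [u] cannot contribute in degree [k + e]. *)
Lemma hcomp_mul_lead e a c u k : a \is e.-homog -> (msize (c - a) <= e)%N ->
  (msize u <= k.+1)%N -> hcomp (k + e) (u * c) = hcomp k u * a.
Proof.
move=> ha sc su; rewrite -[in LHS](subrK a c) mulrDr linearD /= (hcomp_mul_homog _ _ ha).
suff -> : hcomp (k + e) (u * (c - a)) = 0 by rewrite add0r.
apply: hcomp_small; case: e {ha} sc => [|e] sc; last by rewrite addnS -addSn msize_mul_le.
by move: sc; rewrite leqn0 msize_poly_eq0 => /eqP ->; rewrite mulr0 msize0.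
Qed.

(** The top component of [z * c] is that of [z] times [a]. It lies in the graded [J], so regularity
    of [a] puts the top component of [z] in [J]; it is subtracted and the degree drops. *)
Lemma regular_mod_lead J e a c : ideal J -> graded J -> a \is e.-homog ->
  (msize (c - a) <= e)%N -> regular_mod J a -> regular_mod J c.
Proof.
move=> iJ gJ ha sc ra z; move: {2}(msize z) (leqnn (msize z)) => k.
elim: k z => [|k IH] z sz Jz.
  by move: sz; rewrite leqn0 msize_poly_eq0 => /eqP ->; case: iJ.
have Jt : J (hcomp k z) by apply: ra; rewrite -(hcomp_mul_lead ha sc sz); exact: gJ.
apply: (@ideal_subl _ _ _ _ _ iJ _ Jt); apply: IH; first exact: size_sub_hcomp.
by rewrite mulrBl; apply: ideal_sub => //; apply: ideal_mulr.
Qed.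

(** If the multiplier [w] has too large a degree, the product of its top component with [a] is not
    matched by [f] and so lies in [J]. By regularity the component itself does, and it can be
    stripped off. *)
Lemma mem_add_gen_lead J e a c k f : ideal J -> graded J -> a \is e.-homog ->
  (msize (c - a) <= e)%N -> regular_mod J a -> (msize f <= k + e)%N ->
  add_gen J c f -> exists2 z, (msize z <= k)%N & J (f - z * c).
Proof.
move=> iJ gJ ha sc ra sf [j [w [Jj fE]]].
have : J (f - w * c) by rewrite fE addrK.
move: {2}(msize w) (leqnn (msize w)) => m; elim: m w {fE} => [|m IH] w sw Jf.
  by exists w => //; apply: leq_trans sw _.
have [le_mk|lt_km] := leqP m.+1 k; first by exists w => //; exact: leq_trans le_mk.
have Jt : J (hcomp m w).
  apply: ra; rewrite -(hcomp_mul_lead ha sc sw).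
  have := gJ _ Jf (m + e)%N; rewrite linearB /= hcomp_small; last first.
    by apply: leq_trans sf _; rewrite leq_add2r.
  rewrite sub0r => /(@subspaceN _ _ _ _ (ideal_subspace iJ)); by rewrite opprK.
apply: (IH (w - hcomp m w)); first exact: size_sub_hcomp.
rewrite mulrBl opprB addrCA addrC.
by case: (iJ) => _ JD JM; apply: JD => //; exact: ideal_mulr.
Qed.

Lemma subspace_size_le_and k I : ideal I -> subspace (fun f => size_le k f /\ I f).
Proof.
move=> iI; split; first by split; [rewrite /size_le msize0|case: iI].
move=> x u v [su Iu] [sv Iv]; split; first by case: (@subspace_size_le C n k) => _; apply.
by case: (ideal_subspace iI) => _; apply.
Qed.

(* P/(J, c) has the dimension of P/J in degrees below k + e minus that in degrees below k,
   which depends on c only through the degree e of its leading form. *)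
Lemma count_mod J e a c r : ideal J -> graded J -> a \is e.-homog ->
  (msize (c - a) <= e)%N -> regular_mod J a -> has_dim whole (add_gen J c) r ->
  exists K, forall k d d', (K <= k)%N -> has_dim (size_le (k + e)) (fun f =>
    size_le (k + e) f /\ J f) d ->
    has_dim (size_le k) (fun f => size_le k f /\ J f) d' -> d = (r + d')%N.
Proof.
move=> iJ gJ ha sc ra dr; have [K hK] := has_dim_finite_codim dr; exists K =>
  k d d' le_Kk dd dd'.
have iJc := ideal_add_gen c iJ.
have [s ds] := has_dim_size_le (k + e) (ideal_subspace iJc).
have sr : s = r.
  apply: (has_dim_uniq (ideal_subspace iJc)) dr.
  apply: has_dim_whole_size_le ds; first exact: ideal_subspace.
  by move=> f; have [f' sf' ?] := hK f; exists f' => //; apply: leq_trans sf' _; lia.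
have ds' : has_dim (size_le (k + e)) (fun f => size_le (k + e) f /\ add_gen J c f) s.
  apply: (@has_dim_transport _ _ _ id) ds => //; first exact: subspace_size_le.
  - exact: subspace_size_le_and.
  - by move=> u su; split=> [[]|].
  - by move=> v sv; exists v => //; split; rewrite subrr ?msize0 //;
       [rewrite /size_le msize0|case: iJc].
have scc : (msize c <= e.+1)%N.
  rewrite -[c](subrK a); apply: msize_add_le; first exact: leq_trans sc _.
  exact: size_homog.
have sz z : size_le k z -> size_le (k + e) (z * c) by move=> sz; exact: msize_mul_le.
(* Multiplication by [c] identifies the polynomials of degree below [k] modulo [J] with the part of
   [(J, c)] in degree below [k + e] modulo [J]. *)
have dd'' : has_dim (fun f => size_le (k + e) f /\ add_gen J c f)
    (fun f => size_le (k + e) f /\ J f) d'.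
  apply: (@has_dim_transport _ _ _ (fun z => z * c)) dd' => //.
  - by move=> x u v; rewrite mulrDl scalerAl.
  - exact: subspace_size_le.
  - exact: subspace_size_le_and.
  - by move=> u su; split; [exact: sz|exact: mem_add_gen].
  - move=> u su; split=> [[_ Ju]|[_ Ju]].
      by split=> //; apply: (regular_mod_lead iJ gJ ha sc ra).
    by split; [exact: sz|exact: ideal_mulr].
  - move=> v [sv Jv]; have [z szz Jz] := mem_add_gen_lead iJ gJ ha sc ra sv Jv.
    by exists z => //; split=> //; apply: msize_sub_le => //; exact: sz.
apply: (has_dim_uniq (subspace_size_le_and _ iJ) dd); rewrite -sr.
apply: (@has_dimD _ _ _ (fun f => size_le (k + e) f /\ add_gen J c f)) => //.
- exact: subspace_size_le_and.
- by move=> v [? ?]; split=> //; exact: sub_add_gen.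
- exact: subspace_size_le_and.
- exact: subspace_size_le.
- by move=> v [].
Qed.

(** By [count_mod] both dimensions are the difference of the same two counts, taken at [K1 + K2],
    which is large enough for both. *)
Lemma dim_same_degree J e a1 a2 c1 c2 r : ideal J -> graded J ->
  a1 \is e.-homog -> a2 \is e.-homog -> regular_mod J a1 -> regular_mod J a2 ->
  (msize (c1 - a1) <= e)%N -> (msize (c2 - a2) <= e)%N -> finite_codim (add_gen J c2) ->
  has_dim whole (add_gen J c1) r -> has_dim whole (add_gen J c2) r.
Proof.
move=> iJ gJ h1 h2 r1 r2 s1 s2 f2 d1.
have [r' d2] := finite_codim_has_dim (ideal_add_gen c2 iJ) f2.
have [K1 e1] := count_mod iJ gJ h1 s1 r1 d1.
have [K2 e2] := count_mod iJ gJ h2 s2 r2 d2.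
have [d dd] := has_dim_size_le (K1 + K2 + e) (subspace_size_le_and (K1 + K2 + e) iJ).
have [d' dd'] := has_dim_size_le (K1 + K2) (subspace_size_le_and (K1 + K2) iJ).
suff -> : r = r' by [].
have := e1 _ _ _ (leq_addr _ _) dd dd'; have := e2 _ _ _ (leq_addl _ _) dd dd'.
lia.
Qed.

(** The top component of [f] is congruent modulo [J] to a multiple of [a]; replacing [a] by [c]
    there costs only terms of lower degree, and the reduction continues down to the bound [K] that
    serves for [a]. *)
Lemma finite_codim_lead J e a c : ideal J -> graded J -> a \is e.-homog ->
  (msize (c - a) <= e)%N -> finite_codim (add_gen J a) -> finite_codim (add_gen J c).
Proof.
move=> iJ gJ ha sc [K hK]; exists K => f.
move: {2}(msize f) (leqnn (msize f)) => k; elim: k f => [|k IH] f sf.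
  by exists 0; rewrite ?msize0 //; move: sf; rewrite leqn0 msize_poly_eq0 => /eqP ->;
     rewrite subr0; case: (ideal_add_gen c iJ).
have [le_kK|le_Kk] := ltnP k K.
  by exists f; [exact: leq_trans le_kK|rewrite subrr; case: (ideal_add_gen c iJ)].
have Jt : add_gen J a (hcomp k f).
  have [f' sf' Jf] := hK f.
  have := graded_add_gen iJ gJ ha Jf k.
  by rewrite linearB /= (hcomp_small (f := f')) ?subr0 //; exact: leq_trans le_Kk.
have [t [st Jt']] : exists t, (msize t <= k)%N /\ add_gen J c (hcomp k f - t).
  have := graded_add_gen iJ gJ ha Jt k.
  rewrite pihomog_id => -[j [w [Jj _]]]; have [j' [w' [Jj' E]]] := Jt.
  have E' : hcomp k f = hcomp k j' + hcomp k (w' * a).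
    by rewrite -[LHS]pihomog_id E linearD.
  have [le_ek|lt_ke] := leqP e k; last first.
    exists 0; rewrite msize0 subr0; split=> //.
    rewrite E' (hcomp_mul_homog_small _ ha) // addr0.
    by apply: sub_add_gen; exact: gJ.
  exists (hcomp (k - e) w' * (a - c)); split.
    case: e sc ha le_ek {hK Jt} => [|e] sc ha le_ek.
      move: sc; rewrite leqn0 msize_poly_eq0 -opprB oppr_eq0 => /eqP ->.
      by rewrite mulr0 msize0.
    have -> : k = ((k - e.+1).+1 + e)%N by lia.
    apply: msize_mul_le; last by rewrite -opprB msizeN.
    by apply: leq_trans (size_homog (pihomogP _ _ _)) _; lia.
  exists (hcomp k j'), (hcomp (k - e) w'); split; first exact: gJ.
  rewrite E' -{2}(subnK le_ek) hcomp_mul_homog // -addrA -mulrBr; congr (_ + _ * _).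
  by rewrite opprB addrC subrK.
have [f' sf' Jf'] := IH (f - hcomp k f + t) (msize_add_le (size_sub_hcomp sf) st).
exists f' => //; have -> : f - f' = (f - hcomp k f + t - f') + (hcomp k f - t).
  by rewrite addrAC [_ + t]addrC addrACA [f - _ + _]addrAC !addrA; ring.
by case: (ideal_add_gen c iJ) => _ JD _; exact: JD.
Qed.

(** Compare components in [1 = i + v * (a - 1)], [i] in [J]: modulo [J] the component of [v] in
    degree 0 is -1, and the one in degree [k.+1 * e] is [a] times the one in degree [k * e]. Hence
    the latter is [- a ^+ k], and it vanishes for large [k]. *)
Lemma unit_mod_sub1_power J e a : ideal J -> graded J -> a \is e.-homog -> (0 < e)%N ->
  add_gen J (a - 1) 1 -> exists k, J (a ^+ k).
Proof.
move=> iJ gJ ha e0 [i [v [Ji E]]]; have [J0 JD JM] := iJ.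
have {}E : 1 = i + v * a - v by rewrite {1}E mulrBr mulr1 addrA.
have h1 k : hcomp k 1 = if k == 0%N then 1 else 0.
  case: eqP => [->|/eqP k0]; first by rewrite pihomog_dE // dhomog1.
  by rewrite (@pihomog_ne0 _ _ _ 0) 1?eq_sym // dhomog1.
have H k : J (hcomp (k * e) v + a ^+ k).
  elim: k => [|k IH].
    have := congr1 (hcomp 0) E; rewrite h1 linearB linearD /=.
    rewrite (hcomp_mul_homog_small _ ha) // addr0 mul0n expr0 => ->.
    by rewrite addrC subrK; exact: gJ.
  have := congr1 (hcomp (k.+1 * e)) E; rewrite h1 linearB linearD /= mulSn addnC.
  rewrite (hcomp_mul_homog _ _ ha) addn_eq0 [e == _]gtn_eqF // andbF => /esym/eqP.
  rewrite subr_eq0 => /eqP <-; rewrite -addrA exprSr -mulrDl.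
  by apply: JD; [exact: gJ|exact: ideal_mulr].
exists (msize v); have := H (msize v); rewrite hcomp_small ?add0r //.
by rewrite leq_pmulr.
Qed.

End Graded.

(** * Exchange in regular sequences *)

Section Generated.
Context (C : fieldType) (n : nat) (A : finType).
Local Notation P := {mpoly C[n]}.
Implicit Types (I J : P -> Prop) (f g u w b z : P) (a : A -> P) (S : {set A}).

Definition gen S a : P -> Prop := fun f => exists u : A -> P, f = \sum_(i in S) u i * a i.

(* Quantifying over all subfamilies makes regularity independent of the order of the
   sequence, which is what allows its terms to be exchanged one at a time. *)
Definition regular_seq a := forall S i, i \notin S -> regular_mod (gen S a) (a i).

Lemma ideal_gen S a : ideal (gen S a).
Proof.
split.
- by exists (fun=> 0); rewrite big1 // => i _; rewrite mul0r.
- move=> _ _ [u ->] [v ->]; exists (fun i => u i + v i).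
  by rewrite -big_split; apply: eq_bigr => i _; rewrite mulrDl.
- move=> w _ [u ->]; exists (fun i => w * u i).
  by rewrite mulr_sumr; apply: eq_bigr => i _; rewrite mulrA.
Qed.
Hint Resolve ideal_gen : core.

Lemma mem_gen S a i : i \in S -> gen S a (a i).
Proof.
move=> iS; exists (fun j => (j == i)%:R); rewrite (bigD1 i) //= eqxx mul1r.
by rewrite big1 ?addr0 // => j /andP[_ /negbTE ->]; rewrite mul0r.
Qed.

Lemma gen_min S a J f : ideal J -> (forall i, i \in S -> J (a i)) -> gen S a f -> J f.
Proof.
by move=> iJ Ja [u ->]; have [_ _ JM] := iJ; apply: ideal_sum => // i /Ja; exact: JM.
Qed.

Lemma gen_setU1 S a i f : gen (i |: S) a f <-> add_gen (gen S a) (a i) f.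
Proof.
split.
  apply: gen_min; first exact: ideal_add_gen.
  move=> j /setU1P[->|jS]; first exact: gen_add_gen.
  by apply: sub_add_gen; exact: mem_gen.
apply: add_gen_min => //; last by apply: mem_gen; rewrite setU11.
by move=> g; apply: gen_min => // j jS; apply: mem_gen; rewrite setU1r.
Qed.

Lemma graded_gen S a e : (forall i, a i \is (e i).-homog) -> graded (gen S a).
Proof.
move=> ha _ [u ->] k; rewrite linear_sum; apply: ideal_sum => // i iS /=.
have [le_k|lt_k] := leqP (e i) k; last first.
  by rewrite (hcomp_mul_homog_small _ (ha i)) //; case: (ideal_gen S a).
rewrite -(subnK le_k) (hcomp_mul_homog _ _ (ha i)).
by case: (ideal_gen S a) => _ _; apply; exact: mem_gen.
Qed.

(** From [z * y = j + w * b], regularity of [b] gives [w = j' + w' * y]; then [(z - w' * b) * y] is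
    in [J], and regularity of [y] finishes. *)
Lemma regular_mod_swap J y b : ideal J -> regular_mod J y ->
  regular_mod (add_gen J y) b -> regular_mod (add_gen J b) y.
Proof.
move=> iJ ry rb z [j [w [Jj E]]].
have /rb [j' [w' [Jj' E']]] : add_gen J y (w * b).
  have -> : w * b = z * y - j by rewrite E addrC addKr.
  by apply: ideal_sub; [exact: ideal_add_gen|exact: mem_add_gen|exact: sub_add_gen].
exists (z - w' * b), w'; split; last by rewrite subrK.
apply: ry; have -> : (z - w' * b) * y = j + b * j' by rewrite mulrBl E E'; ring.
by case: iJ => _ JD JM; apply: JD => //; exact: JM.
Qed.

(** If [z * b] is in [J], then [z] is [z' * y] modulo [J] with [z'] of smaller degree, and [z' * b]
    is again in [J] since [y] is regular. The positive degree of [y] makes this a descent. *)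
Lemma regular_mod_descent J e y b : ideal J -> graded J -> y \is e.-homog -> (0 < e)%N ->
  regular_mod J y -> regular_mod (add_gen J y) b -> regular_mod J b.
Proof.
move=> iJ gJ hy e0 ry rb z; move: {2}(msize z) (leqnn (msize z)) => k.
elim: k z => [|k IH] z sz Jz.
  by move: sz; rewrite leqn0 msize_poly_eq0 => /eqP ->; case: iJ.
have sy : (msize (y - y) <= e)%N by rewrite subrr msize0.
have szk : (msize z <= k + e)%N by apply: leq_trans sz _; lia.
have [z' sz' Jz'] := mem_add_gen_lead iJ gJ hy sy ry szk (rb _ (sub_add_gen _ Jz)).
suff Jz'' : J z' by apply: (ideal_subl iJ Jz'); exact: ideal_mulr.
apply: IH => //; apply: ry.
have -> : z' * b * y = z * b - (z - z' * y) * b by ring.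
by apply: ideal_sub => //; exact: ideal_mulr.
Qed.

Lemma regular_mod_exp J b k : regular_mod J b -> regular_mod J (b ^+ k).
Proof.
move=> ra; elim: k => [|k IH] z; first by rewrite expr0 mulr1.
by rewrite exprSr mulrA => /ra /IH.
Qed.

Definition replace a i b : A -> P := fun j => if j == i then b else a j.

Lemma gen_replace S a i b f : i \notin S -> gen S (replace a i b) f <-> gen S a f.
Proof.
move=> iS; have E j : j \in S -> replace a i b j = a j.
  by rewrite /replace; case: eqP iS => // -> /negbTE ->.
by split; apply: gen_min => // j jS; [rewrite E|rewrite -E]=> //; exact: mem_gen.
Qed.

Lemma regular_mod_eq I J b : (forall f, I f <-> J f) -> regular_mod I b -> regular_mod J b.
Proof. by move=> E r z /E /r /E. Qed.

Lemma replace_eq a i b : replace a i b i = b. Proof. by rewrite /replace eqxx. Qed.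

Lemma regular_seq_replace a e i b : (forall j, a j \is (e j).-homog) ->
  (forall j, (0 < e j)%N) -> regular_seq a -> regular_mod (gen [set~ i] a) b ->
  regular_seq (replace a i b).
Proof.
move=> ha e0 ra rb.
(* Starting from the set of all other terms, [b] stays regular when they are removed one at a
   time. *)
have rbS S : i \notin S -> regular_mod (gen S a) b.
  move: {2}(#|~: S|) (leqnn #|~: S|) => k; elim: k S => [|k IH] S.
    by rewrite leqn0 cards_eq0 => /eqP/setP/(_ i); rewrite !inE => ->.
  move=> cS iS; have [SE|[j /andP[ji jS]]] : S = [set~ i] \/ exists j, (j != i) && (j \notin S).
    have [/existsP|/existsPn h] := boolP [exists j, (j != i) && (j \notin S)]; first by right.
    left; apply/setP => j; rewrite !inE; have := h j; case: eqP => [->|_] /=.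
      by rewrite (negbTE iS).
    by rewrite negbK.
  - by rewrite SE.
  - apply: (@regular_mod_descent (gen S a) (e j) (a j) b) => //;
    [exact: graded_gen ha|exact: ra|].
    apply: (@regular_mod_eq (gen (j |: S) a)); first by move=> f; exact: gen_setU1.
    apply: IH; last by rewrite !inE negb_or eq_sym ji.
    rewrite -ltnS; apply: leq_trans cS; apply: proper_card; apply/properP; split.
      by apply/fintype.subsetP => x; rewrite !inE; case: (x \in S); rewrite ?orbT.
    by exists j; rewrite !inE ?eqxx.
move=> S k kS; rewrite {2}/replace; case: (eqVneq k i) => [ki|ki].
  move: kS; rewrite ki => iS.
  apply: (@regular_mod_eq (gen S a)) (rbS _ iS) => f.
  by split=> /(gen_replace _ _ _ iS).
have [iS|iS] := boolP (i \in S); last first.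
  apply: (@regular_mod_eq (gen S a)) (ra _ _ kS) => f.
  by split=> /(gen_replace _ _ _ iS).
have iS' : i \notin S :\ i by rewrite !inE eqxx.
have kS' : k \notin S :\ i by rewrite !inE ki.
(* In the order [a k], [b] after [S :\ i] both are regular; swapping them makes [a k] regular after
   [b]. *)
have : regular_mod (add_gen (gen (S :\ i) a) b) (a k).
  apply: regular_mod_swap => //; first exact: ra.
  apply: (@regular_mod_eq (gen (k |: (S :\ i)) a)); first by move=> f; exact: gen_setU1.
  by apply: rbS; rewrite !inE eqxx andFb orbF eq_sym.
apply: regular_mod_eq => f; rewrite -[S in gen S (replace _ _ _)](finset.setD1K iS); split.
  move=> h; apply/gen_setU1; move: h; rewrite replace_eq.
  apply: add_gen_min; first exact: ideal_add_gen.
    by move=> g /(gen_replace _ _ _ iS') ?; exact: sub_add_gen.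
  exact: gen_add_gen.
move/gen_setU1; rewrite replace_eq.
apply: add_gen_min; first exact: ideal_add_gen.
  by move=> g /(gen_replace _ _ _ iS') ?; exact: sub_add_gen.
exact: gen_add_gen.
Qed.

(** Divide [f] by [b], then divide the quotient by [b ^+ k]: the remainders combine to
    [f' + w' * b], of bounded degree. *)
Lemma finite_codim_exp J b k : ideal J -> finite_codim (add_gen J b) ->
  finite_codim (add_gen J (b ^+ k)).
Proof.
move=> iJ [K hK]; have [J0 JD JM] := iJ; elim: k => [|k [L hL]].
  exists 0%N => f; exists 0; rewrite ?msize0 // subr0 expr0 -[f]mulr1.
  exact: mem_add_gen.
exists (K + (L + msize b))%N => f; have [f' sf' [j [w [Jj E]]]] := hK f.
have [w' sw' [j' [v [Jj' E']]]] := hL w; exists (f' + w' * b).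
  apply: msize_add_le; first exact: leq_trans sf' (leq_addr _ _).
  by apply: leq_trans (leq_addl _ _); apply: msize_mul_le => //; exact: leqnSn.
exists (j + b * j'), v; split; first by apply: JD => //; exact: JM.
have -> : f - (f' + w' * b) = (f - f') - w' * b by ring.
rewrite E exprS; have -> : w = j' + v * b ^+ k + w' by rewrite -E' subrK.
by ring.
Qed.

End Generated.
#[global] Hint Resolve ideal_gen : core.

Section Exchange.
Context (C : closedFieldType) (n : nat) (A : finType).
Local Notation P := {mpoly C[n]}.
Implicit Types (a : A -> P) (b : P).

Definition complete_intersection (e : A -> nat) a r :=
  [/\ forall i, a i \is (e i).-homog, regular_seq a & has_dim whole (gen [set: A] a) r].

Lemma gen_setT a i f : gen [set: A] a f <-> add_gen (gen [set~ i] a) (a i) f.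
Proof.
have -> : [set: A] = i |: [set~ i] by rewrite finset.setUCr.
exact: gen_setU1.
Qed.

(** By the Nullstellensatz [b] is a unit modulo the other terms and [a i - 1]. Gradedness turns this
    into a power of [a i] in the ideal [(J, b)], and that power transfers both regularity and finite
    codimension from [a i] to [b]. *)
Lemma exchange e a r i b : (forall j, (0 < e j)%N) -> complete_intersection e a r ->
  b \is (e i).-homog ->
  (forall v, is_zero (add_gen (gen [set~ i] a) (a i - 1)) v -> b.@[v 0] <> 0) ->
  complete_intersection e (replace a i b) r.
Proof.
move=> e0 [ha ra da] hb nz.
pose J := gen [set~ i] a; have iJ : ideal J by exact: ideal_gen.
have gJ : graded J := graded_gen ha.
have daJ : has_dim whole (add_gen J (a i)) r.
  by apply: has_dim_eq da => // f; exact: gen_setT.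
have faJ := has_dim_finite_codim daJ.
have s1 : (msize (a i - 1 - a i) <= e i)%N by rewrite addrC addKr msizeN msize1.
have fa1 := finite_codim_lead iJ gJ (ha i) s1 faJ.
have one := zero_free_unit (ideal_add_gen _ iJ) fa1 nz.
have [k [j [w [Jj E]]]] : exists k, add_gen J b (a i ^+ k).
  apply: (unit_mod_sub1_power (ideal_add_gen b iJ) (graded_add_gen iJ gJ hb) (ha i)) => //.
  have iJ' := ideal_add_gen (a i - 1) (ideal_add_gen b iJ).
  apply: add_gen_min one => //; last by apply: sub_add_gen; exact: gen_add_gen.
  move=> g; apply: add_gen_min => //; last exact: gen_add_gen (ideal_add_gen b iJ).
  by move=> ? ?; do 2 apply: sub_add_gen.
have raJ : regular_mod J (a i) by apply: ra; rewrite !inE eqxx.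
have rb : regular_mod J b.
  move=> z Jz; apply: (regular_mod_exp (k := k) raJ).
  rewrite E mulrDr [w * b]mulrC mulrA; case: (iJ) => _ JD JM.
  by apply: JD; [exact: JM|exact: ideal_mulr].
have fb : finite_codim (add_gen J b).
  apply: finite_codim_sub (finite_codim_exp k iJ faJ) => f.
  apply: add_gen_min; first exact: ideal_add_gen.
    by move=> g; exact: sub_add_gen.
  by exists j, w.
have ra' := regular_seq_replace ha e0 ra rb.
split=> //.
  by move=> j'; rewrite /replace; case: eqP => // ->.
have s0 c : (msize (c - c : P) <= e i)%N by rewrite subrr msize0.
have := dim_same_degree iJ gJ (ha i) hb raJ rb (s0 _) (s0 _) fb daJ.
apply: has_dim_eq => // f; have iN : i \notin [set~ i] by rewrite !inE eqxx.
split=> [|/(gen_setT _ i)]; last first.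
  rewrite replace_eq; apply: add_gen_min; first exact: ideal_add_gen.
    by move=> g /(gen_replace _ _ _ iN) ?; exact: sub_add_gen.
  exact: gen_add_gen.
move=> h; apply/(gen_setT _ i); move: h; rewrite replace_eq.
apply: add_gen_min; first exact: ideal_add_gen.
  by move=> g /(gen_replace _ _ _ iN) ?; exact: sub_add_gen.
exact: gen_add_gen.
Qed.

(** The coefficients are taken on the curve of powers of [t]: each [w] gives a nonzero polynomial in
    [t], and the product of these polynomials has a nonroot. *)
Lemma generic_combination m (T : seq ('I_m -> C)) :
  (forall w, List.In w T -> exists j, w j != 0) ->
  exists c : 'rV[C]_m, forall w, List.In w T -> \sum_j c 0 j * w j <> 0.
Proof.
move=> nz; pose p (w : 'I_m -> C) := \poly_(k < m) (if insub k is Some j then w j else 0).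
have pE w t : (p w).[t] = \sum_(j < m) t ^+ j * w j.
  rewrite horner_poly; apply: eq_bigr => j _; rewrite mulrC; congr (_ * _).
  by rewrite valK.
have : \prod_(w <- T) p w != 0.
  elim: T nz => [|w T IH] nz; first by rewrite big_nil oner_eq0.
  rewrite big_cons mulf_neq0 //; last by apply: IH => w' h; apply: nz; right.
  have [j wj] := nz w (or_introl erefl).
  apply: contraNneq wj => /(congr1 (coefp j)); rewrite /= coef_poly ltn_ord valK.
  by rewrite coef0 => ->.
move/closed_nonrootP => [t nt]; exists (\row_j t ^+ j) => w wT.
have : ~~ root (p w) t.
  elim: T wT nt {nz} => //= w' T IH [->|wT]; rewrite big_cons rootM negb_or => /andP[]//.
  by move=> _; exact: IH.
rewrite /root pE => /eqP h; under eq_bigr do rewrite mxE.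
exact: h.
Qed.

End Exchange.

(** * Substitution in polynomials *)

Section Substitution.
Context (C : fieldType).

Definition subst n k (l : 'I_n -> {mpoly C[k]}) (p : {mpoly C[n]}) : {mpoly C[k]} :=
  p \mPo [tuple l i | i < n].

Section Morphism.
Context (n k : nat) (l : 'I_n -> {mpoly C[k]}).

Lemma substC c : subst l c%:MP = c%:MP. Proof. exact: comp_mpolyC. Qed.
Lemma subst1 : subst l 1 = 1. Proof. exact: rmorph1. Qed.
Lemma substD p q : subst l (p + q) = subst l p + subst l q.
Proof. exact: rmorphD. Qed.
Lemma substB p q : subst l (p - q) = subst l p - subst l q.
Proof. exact: rmorphB. Qed.
Lemma substM p q : subst l (p * q) = subst l p * subst l q.
Proof. exact: rmorphM. Qed.
Lemma substXn p e : subst l (p ^+ e) = subst l p ^+ e.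
Proof. exact: rmorphXn. Qed.
Lemma subst_sum A (r : seq A) (Q : pred A) F :
  subst l (\sum_(i <- r | Q i) F i) = \sum_(i <- r | Q i) subst l (F i).
Proof. exact: raddf_sum. Qed.
Lemma substXU i : subst l 'X_i = l i.
Proof. by rewrite /subst comp_mpolyXU -tnth_nth tnth_mktuple. Qed.
Lemma subst_linear : linear (subst l).
Proof. by move=> c u v; rewrite /subst linearP. Qed.

Lemma meval_subst p v : (subst l p).@[v] = p.@[fun i => (l i).@[v]].
Proof. by rewrite comp_mpoly_meval; apply: meval_eq => i; rewrite tnth_mktuple. Qed.

Lemma homog_subst p d e : p \is d.-homog -> (forall i, l i \is e.-homog) ->
  subst l p \is (d * e).-homog.
Proof.
move=> /dhomogP hp hl; rewrite /subst comp_mpolyE big_seq; apply: rpred_sum => m mp.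
apply: dhomogZ; rewrite -(hp m mp) /= mdegE big_distrl /=.
elim/big_rec2: _ => [|i y x _ hx]; first exact: dhomog1.
by rewrite tnth_mktuple; apply: dhomogM => //; rewrite mulnC; exact: dhomogMn.
Qed.

Lemma subst_congr I (l' : 'I_n -> {mpoly C[k]}) p : ideal I -> (forall i, I (l i - l' i)) ->
  I (subst l p - subst l' p).
Proof.
move=> iI Il; have [I0 ID IM] := iI; elim/mpoly_ring_ind: p => [c|i|g h Ig Ih|g h Ig Ih].
- by rewrite /subst !comp_mpolyC subrr.
- by rewrite /subst !comp_mpolyXU -!tnth_nth !tnth_mktuple.
- by rewrite /subst !comp_mpolyD opprD addrACA; exact: ID.
- rewrite /subst !rmorphM /= -/(subst l g) -/(subst l h) -/(subst l' g) -/(subst l' h).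
  have -> : subst l g * subst l h - subst l' g * subst l' h =
     subst l g * (subst l h - subst l' h) + subst l' h * (subst l g - subst l' g) by ring.
  by apply: ID; exact: IM.
Qed.

End Morphism.

Lemma subst_id n (p : {mpoly C[n]}) : subst (fun i => 'X_i) p = p.
Proof. exact: comp_mpoly_id. Qed.

Lemma subst_subst n k m (l : 'I_n -> {mpoly C[k]}) (l' : 'I_k -> {mpoly C[m]}) p :
  subst l' (subst l p) = subst (fun i => subst l' (l i)) p.
Proof.
elim/mpoly_ring_ind: p => [c|i|g h IHg IHh|g h IHg IHh].
- by rewrite !substC.
- by rewrite !substXU.
- by rewrite !substD IHg IHh.
- by rewrite !substM IHg IHh.
Qed.

Lemma meval_homog n (p : {mpoly C[n]}) d t (v : 'I_n -> C) : p \is d.-homog ->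
  p.@[fun i => t * v i] = t ^+ d * p.@[v].
Proof.
move=> /dhomogP hp; rewrite !mevalE big_distrr /= !big_seq; apply: eq_bigr => m mp.
rewrite -(hp m mp) /= mdegE -prodrXr mulrCA -big_split; congr (_ * _).
by apply: eq_bigr => i _; rewrite exprMn.
Qed.

Lemma meval0_homog n (p : {mpoly C[n]}) d : (0 < d)%N -> p \is d.-homog ->
  p.@[(0 : 'rV[C]_n) 0] = 0.
Proof.
move=> d0 hp; rewrite (meval_eq (v2 := fun i => 0 * (0 : 'rV[C]_n) 0 i)) => [|i].
  by rewrite (meval_homog _ _ hp) expr0n gtn_eqF // mul0r.
by rewrite mxE mul0r.
Qed.

End Substitution.

(** * Powers of distinct variables as a regular sequence *)

Section MonomialSequence.
Context (C : fieldType) (N : nat) (A : finType) (var : A -> 'I_N) (e : A -> nat).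
Hypothesis var_inj : injective var.
Local Notation P := {mpoly C[N]}.

Definition var_power i : P := 'X_(var i) ^+ e i.

Lemma homog_var_power i : var_power i \is (e i).-homog.
Proof. by rewrite -[e i]mul1n; apply: dhomogMn; rewrite dhomogX; apply/eqP/mdeg1. Qed.

Lemma gen_var_power (S : {set A}) f :
  gen S var_power f <-> (forall m, m \in msupp f -> exists2 i, i \in S & (e i <= m (var i))%N).
Proof.
split=> [[u ->]|h].
  elim/big_rec: _ => [m|i g iS IH m]; first by rewrite msupp0.
  move=> /msuppD_le; rewrite mem_cat => /orP[|/IH//].
  rewrite /var_power mpolyXn => /msuppM_le/allpairsP[[m1 m2] /= [_ + ->]].
  rewrite msuppX inE => /eqP ->; exists i => //.
  by rewrite mnmDE mulmnE mnm1E eqxx mul1n leq_addl.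
rewrite [f]mpolyE big_seq; apply: ideal_sum => // m /h [i iS le_m].
rewrite -mul_mpolyC; have [_ _ JM] := ideal_gen S var_power; apply: (JM).
have -> : 'X_[m] = 'X_[(m - U_(var i) *+ e i)%MM] * var_power i :> P.
  rewrite /var_power mpolyXn -mpolyXD submK //; apply/mnm_lepP => j.
  by rewrite mulmnE mnm1E; case: eqP => [<-|]; rewrite ?mul1n.
by apply: JM; exact: mem_gen.
Qed.

(** Membership in a monomial ideal is decided monomial by monomial, and multiplying by a power of
    [var i] changes no exponent that the members of [S] look at. *)
Lemma regular_seq_var_power : regular_seq var_power.
Proof.
move=> S i iS z /gen_var_power h; apply/gen_var_power => m mz.
have [|j jS le_m] := h (m + U_(var i) *+ e i)%MM.
  by rewrite /var_power mpolyXn mcoeff_msupp addmC mcoeffMX -mcoeff_msupp.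
exists j => //; move: le_m; rewrite mnmDE mulmnE mnm1E (inj_eq var_inj).
by case: eqP iS => [->|_ _]; rewrite ?jS // mul0n addn0.
Qed.

Lemma has_dim_var_power (K : finType) (mon : K -> 'X_{1..N}) :
  injective mon -> (forall m, (exists k, mon k = m) <-> (forall i, (m (var i) < e i)%N)) ->
  has_dim whole (gen [set: A] var_power) #|K|.
Proof.
move=> mon_inj monP; pose mk (j : 'I_#|K|) := mon (enum_val j).
have mk_inj : injective mk by move=> i j /mon_inj/enum_val_inj.
pose b j : P := 'X_[mk j].
have coef c j : (lincomb c b)@_(mk j) = c 0 j.
  rewrite /lincomb raddf_sum (bigD1 j) //= big1 ?addr0 => [|k kj].
    by rewrite mcoeffZ mcoeffX eqxx mulr1.
  by rewrite mcoeffZ mcoeffX (inj_eq mk_inj) (negbTE kj) mulr0.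
exists b; split=> // [f _|c /gen_var_power h]; last first.
  apply/rowP => j; rewrite mxE; apply/eqP/contraT => cj.
  have [|i _ le_e] := h (mk j); first by rewrite mcoeff_msupp coef.
  have /(_ i) := (monP (mk j)).1 (ex_intro _ (enum_val j) erefl).
  by rewrite ltnNge le_e.
exists (\row_j f@_(mk j)); apply/gen_var_power => m.
rewrite mcoeff_msupp mcoeffB => nz; apply: contrapT => h.
have /(monP m).2[k km] : forall i, (m (var i) < e i)%N.
  by move=> i; rewrite ltnNge; apply/negP => le_e; apply: h; exists i; rewrite ?inE.
move: nz; have -> : m = mk (enum_rank k) by rewrite /mk enum_rankK.
by rewrite coef mxE subrr eqxx.
Qed.

End MonomialSequence.

(** * Bezout's count for forms without common zero at infinity *)

Section Bezout.
Context (C : closedFieldType) (n D : nat).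
Hypothesis D_gt0 : (0 < D)%N.
Local Notation P := {mpoly C[n.+1]}.
Local Notation last_var := ('X_ord_max : P).

(* The last of the n + 1 variables is the homogenizing one. *)
Definition hvar (i : option 'I_n) : 'I_n.+1 := oapp (lift ord_max) ord_max i.
Definition hdeg (i : option 'I_n) : nat := if i is Some _ then D else 1%N.

Lemma hvar_inj : injective hvar.
Proof.
by move=> [i|] [j|] //= => [/lift_inj ->|/eqP|/eqP] //;
   rewrite ?(negbTE (neq_lift _ _)) // eq_sym (negbTE (neq_lift _ _)).
Qed.

Lemma hdeg_gt0 i : (0 < hdeg i)%N. Proof. by case: i. Qed.

(** The monomials outside the ideal have exponent 0 in the homogenizing variable and exponents below
    [D] in the others. *)
Lemma complete_intersection_var_power :
  complete_intersection hdeg (var_power C hvar hdeg) (D ^ n).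
Proof.
split; [exact: homog_var_power|exact: regular_seq_var_power hvar_inj|].
pose mon (g : {ffun 'I_n -> 'I_D}) : 'X_{1..n.+1} :=
  [multinom (if unlift ord_max k is Some i then g i : nat else 0%N) | k < n.+1].
have monS g i : mon g (lift ord_max i) = g i by rewrite mnmE liftK.
have mon0 g : mon g ord_max = 0%N by rewrite mnmE unlift_none.
have := @has_dim_var_power C n.+1 _ hvar hdeg _ mon.
rewrite card_ffun !card_ord; apply.
  by move=> g g' E; apply/ffunP => i; apply/val_inj; rewrite /= -!monS E.
move=> m; split=> [[g <-] [i|]|h]; rewrite /= ?monS ?mon0 //.
exists [ffun i => Ordinal (h (Some i))]; apply/mnmP => k.
case: (unliftP ord_max k) => [i|] ->; first by rewrite monS ffunE.
by rewrite mon0; have := h None; rewrite /= ltnS leqn0 => /eqP.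
Qed.

Section Homogeneous.
Variable G : 'I_n -> P.
Hypothesis homG : forall j, G j \is D.-homog.
Hypothesis zeroG : forall v : 'rV[C]_n.+1, v 0 ord_max = 0 ->
  (forall j, (G j).@[v 0] = 0) -> v = 0.

Lemma generic_exchange k : (k <= n)%N -> exists (a : option 'I_n -> P) (M : 'M[C]_n),
  [/\ complete_intersection hdeg a (D ^ n), a None = last_var &
      forall i : 'I_n, (i < k)%N -> a (Some i) = \sum_j M i j *: G j].
Proof.
elim: k => [_|k IH lt_kn].
  by exists (var_power C hvar hdeg), 0; split=> //; exact: complete_intersection_var_power.
have [a [M [ciA aN aS]]] := IH (ltnW lt_kn); have [ha ra da] := ciA.
pose i0 := Some (Ordinal lt_kn).
pose I0 := add_gen (gen [set~ i0] a) (a i0 - 1).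
have iI0 : ideal I0 by apply: ideal_add_gen; exact: ideal_gen.
have fI0 : finite_codim I0.
  apply: (finite_codim_lead (e := hdeg i0) (a := a i0)) => //.
  - exact: graded_gen ha.
  - by rewrite addrC addKr msizeN msize1.
  - apply: (has_dim_finite_codim (N := D ^ n)).
    by apply: has_dim_eq da => // f; exact: gen_setT.
have [s _ sP] := finite_zeros iI0 fI0.
have [|c hc] := @generic_combination C n [seq (fun j => (G j).@[(v : 'rV_n.+1) 0]) | v <- s].
  move=> _ /List.in_map_iff[v [<- vs]].
  have zv : is_zero I0 v by apply/sP; elim: s vs {sP} => //= x s IHs [->|/IHs];
    rewrite inE ?eqxx // => ->; rewrite orbT.
  (* As [last_var] belongs to the sequence, a zero [v] of [I0] lies at infinity. If all [G j]
     vanished there, [v] would be 0, where [a i0] is 0 and not 1. *)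
  apply: contrapT => nz; have v0 : v = 0.
    apply: zeroG.
      have : I0 last_var by apply: sub_add_gen; rewrite -aN; apply: mem_gen; rewrite !inE.
      by move/zv; rewrite mevalXU.
    by move=> j; apply/eqP/negPn/negP => h; apply: nz; exists j.
  have := zv _ (gen_add_gen _ (ideal_gen _ _)); rewrite mevalB meval1 v0.
  by rewrite (meval0_homog (hdeg_gt0 i0) (ha i0)) sub0r => /eqP; rewrite oppr_eq0 oner_eq0.
pose b := \sum_j c 0 j *: G j.
have hb : b \is (hdeg i0).-homog by apply: rpred_sum => j _; exact: dhomogZ.
exists (replace a i0 b), (\matrix_(i, j) if (i : nat) == k then c 0 j else M i j); split.
- apply: exchange => // [j|v /sP vs]; first exact: hdeg_gt0.
  rewrite /b raddf_sum; under eq_bigr do rewrite /= mevalZ.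
  apply: hc (fun j => (G j).@[v 0]) _; apply/List.in_map_iff; exists v; split=> //.
  by elim: s vs {sP} => //= x s IHs; rewrite inE => /orP[/eqP ->|/IHs]; [left|right].
- by rewrite /replace.
- move=> i; rewrite ltnS leq_eqVlt /replace /i0 => /orP[/eqP ik|lt_ik].
    have -> : i = Ordinal lt_kn by exact: val_inj.
    by rewrite eqxx; apply: eq_bigr => j _; rewrite mxE eqxx.
  have ik : Some i == Some (Ordinal lt_kn) = false.
    by apply/eqP => -[E]; move: lt_ik; rewrite E ltnn.
  rewrite ik aS //; apply: eq_bigr => j _; rewrite mxE ifF //.
Qed.

Lemma has_dim_dehomogenized : has_dim whole (add_gen (gen [set: 'I_n] G) (last_var - 1)) (D ^ n).
Proof.
have [a [M [[ha ra da] aN aS]]] := generic_exchange (leqnn n).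
have {}aS i : a (Some i) = \sum_j M i j *: G j by exact: aS.
(* A relation among the rows of [M] puts some [a (Some i)] in the ideal of the other terms; by
   regularity this ideal contains 1, yet all its elements vanish at the origin. *)
have uM : M \in unitmx.
  rewrite -row_free_unit -kermx_eq0; apply/eqP/row_matrixP => l; rewrite row0.
  set w := row l _; have wM : w *m M = 0 by rewrite -row_mul mulmx_ker row0.
  apply: contrapT => /eqP/rV0Pn[i wi].
  have E : \sum_k w 0 k *: a (Some k) = 0.
    under eq_bigr do rewrite aS scaler_sumr.
    rewrite exchange_big big1 // => j _; under eq_bigr do rewrite scalerA.
    rewrite -scaler_suml; have /matrixP/(_ 0 j) := wM; rewrite !mxE => ->.
    by rewrite scale0r.
  have J1 : gen [set~ Some i] a 1.
    apply: (ra _ (Some i)); first by rewrite !inE eqxx.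
    rewrite mul1r; move/eqP: E; rewrite (bigD1 i) //= addr_eq0 => /eqP E.
    have -> : a (Some i) = (w 0 i)^-1 *: - \sum_(k | k != i) w 0 k *: a (Some k).
      by rewrite -E scalerA mulVf // scale1r.
    have sJ := ideal_subspace (ideal_gen [set~ Some i] a).
    apply: subspaceZ => //; apply: subspaceN => //; apply: subspace_sum => // k ki.
    by apply: subspaceZ => //; apply: mem_gen; rewrite !inE.
  have z0 : is_zero (gen [set~ Some i] a) 0.
    move=> f [u ->]; rewrite raddf_sum big1 // => k _; rewrite /= mevalM.
    by rewrite (meval0_homog (hdeg_gt0 k) (ha k)) mulr0.
  by move/eqP: (z0 _ J1); rewrite meval1 oner_eq0.
have genE f : gen [set~ None] a f <-> gen [set: 'I_n] G f.
  split; apply: gen_min; try exact: ideal_gen.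
    move=> [i|]; rewrite !inE // => _; rewrite aS.
    apply: subspace_sum => [|j _]; first exact/ideal_subspace/ideal_gen.
    by apply: subspaceZ; [exact/ideal_subspace/ideal_gen|exact: mem_gen].
  move=> j _; have -> : G j = \sum_i (invmx M) j i *: a (Some i).
    under eq_bigr do rewrite aS scaler_sumr.
    rewrite exchange_big (bigD1 j) //= [X in _ + X]big1 ?addr0 => [|k kj].
      under eq_bigr do rewrite scalerA.
      rewrite -scaler_suml; have /matrixP/(_ j j) := mulVmx uM; rewrite !mxE eqxx => ->.
      by rewrite scale1r.
    under eq_bigr do rewrite scalerA.
    rewrite -scaler_suml; have /matrixP/(_ j k) := mulVmx uM.
    by rewrite !mxE eq_sym (negbTE kj) => ->; rewrite scale0r.
  apply: subspace_sum => [|i _]; first exact/ideal_subspace/ideal_gen.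
  by apply: subspaceZ; [exact/ideal_subspace/ideal_gen|apply: mem_gen; rewrite !inE].
pose J := gen [set: 'I_n] G; have iJ : ideal J by exact: ideal_gen.
have gJ : graded J := graded_gen homG.
have hX : last_var \is 1.-homog by rewrite dhomogX; apply/eqP/mdeg1.
have rX : regular_mod J last_var.
  apply: (regular_mod_eq genE); rewrite -aN; apply: ra; by rewrite !inE.
have s1 : (msize (last_var - 1 - last_var) <= 1)%N by rewrite addrC addKr msizeN msize1.
have s0 : (msize (last_var - last_var) <= 1)%N by rewrite subrr msize0.
have dX : has_dim whole (add_gen J last_var) (D ^ n).
  apply: has_dim_eq da => // f; split=> [/(gen_setT _ None)|]; rewrite ?aN.
    apply: add_gen_min; first exact: ideal_add_gen.
      by move=> g /genE; exact: sub_add_gen.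
    exact: gen_add_gen.
  move=> h; apply/(gen_setT _ None); move: h; rewrite aN.
  apply: add_gen_min; first by apply: ideal_add_gen; exact: ideal_gen.
    by move=> g /genE; exact: sub_add_gen.
  by apply: gen_add_gen; exact: ideal_gen.
(* [last_var] and [last_var - 1] have the same leading form, so the quotient at infinity and the
   affine one have equal dimension. *)
apply: (dim_same_degree iJ gJ hX hX rX rX s0 s1 _ dX).
exact: finite_codim_lead s1 (has_dim_finite_codim dX).
Qed.

End Homogeneous.
End Bezout.

(** * Fixed points of homogeneous polynomial maps *)

Section AffineBezout.
Context (C : closedFieldType) (n D : nat) (h : 'I_n -> {mpoly C[n]}).
Hypothesis D_gt1 : (1 < D)%N.
Hypothesis hom_h : forall i, h i \is D.-homog.
Hypothesis zero_h : forall v : 'rV[C]_n, (forall i, (h i).@[v 0] = 0) -> v = 0.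

Theorem bezout_fixpoints :
  has_dim whole (gen [set: 'I_n] (fun i => h i - 'X_i)) (D ^ n).
Proof.
have D_gt0 := ltnW D_gt1; pose T : {mpoly C[n.+1]} := 'X_ord_max.
pose up i : {mpoly C[n.+1]} := 'X_(lift ord_max i).
pose down (k : 'I_n.+1) : {mpoly C[n]} := oapp (fun i => 'X_i) 1 (unlift ord_max k).
have downT : subst down T = 1 by rewrite substXU /down unlift_none.
have downup i : subst down (up i) = 'X_i by rewrite substXU /down liftK.
have downupK p : subst down (subst up p) = p.
  rewrite subst_subst; under [X in subst X]funext do rewrite downup.
  exact: subst_id.
(* The homogenization of [h i - 'X_i]; the exponent [D.-1] is positive, so setting [T] to 0 leaves
   [h i] alone. *)
pose G i := subst up (h i) - up i * T ^+ D.-1.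
have hup i : up i \is 1.-homog by rewrite dhomogX; apply/eqP/mdeg1.
have hT : T \is 1.-homog by rewrite dhomogX; apply/eqP/mdeg1.
have homG i : G i \is D.-homog.
  apply: rpredB; first by rewrite -[D]muln1; exact: homog_subst.
  have hTk k : T ^+ k \is k.-homog by have := dhomogMn k hT; rewrite mul1n.
  by have := dhomogM (hup i) (hTk D.-1); rewrite add1n prednK.
have zG (v : 'rV[C]_n.+1) : v 0 ord_max = 0 -> (forall j, (G j).@[v 0] = 0) -> v = 0.
  move=> vT vG; have : (\row_i v 0 (lift ord_max i)) = 0.
    apply: zero_h => i; have := vG i; rewrite mevalB mevalM rmorphXn /= !mevalXU vT.
    rewrite expr0n -subn1 subn_eq0 leqNgt D_gt1 mulr0 subr0 meval_subst => <-.
    by apply: meval_eq => j; rewrite mxE mevalXU.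
  move=> v0; apply/rowP => k; rewrite mxE.
  case: (unliftP ord_max k) => [i|] -> //.
  by have /rowP/(_ i) := v0; rewrite !mxE.
have dG := has_dim_dehomogenized D_gt0 homG zG.
pose W := add_gen (gen [set: 'I_n] G) (T - 1).
have iW : ideal W by apply: ideal_add_gen; exact: ideal_gen.
pose J := gen [set: 'I_n] (fun i => h i - 'X_i).
have iJ : ideal J by exact: ideal_gen.
have downG i : subst down (G i) = h i - 'X_i.
  by rewrite substB downupK substM downup substXn downT expr1n mulr1.
have WT k : W (T ^+ k - 1).
  by rewrite subrX1; apply: ideal_mulr => //; apply: gen_add_gen; exact: ideal_gen.
(* [down] sets [T] to 1 and [up] includes the old variables; modulo [T - 1] they are inverse to each
   other. *)
have Wup p : W (p - subst up (subst down p)).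
  rewrite -[X in X - _]subst_id subst_subst; apply: subst_congr => // k.
  case: (unliftP ord_max k) => [i|] ->.
    by rewrite /down liftK /= substXU subrr; case: iW.
  by rewrite /down unlift_none /= subst1 -[X in X - _]expr1; exact: WT.
have JW p : J p -> W (subst up p).
  move=> [u ->]; rewrite subst_sum; apply: ideal_sum => // i _; rewrite substM.
  case: (iW) => _ WD WM; apply: (WM); rewrite substB substXU.
  have -> : subst up (h i) - up i = G i + up i * (T ^+ D.-1 - 1) by rewrite /G; ring.
  by apply: WD; [apply: sub_add_gen; exact: mem_gen|exact: WM].
apply: (has_dim_transport (phi := subst down)) dG => //.
- exact: subst_linear.
- exact: ideal_subspace.
- move=> u _; split=> [/JW Wu|].
    by apply: ideal_subl iW (Wup u) Wu.
  move=> [j [w [[v ->] ->]]]; rewrite substD substM substB downT subst1 subrr mulr0 addr0.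
  by rewrite subst_sum; apply: ideal_sum => // i _; rewrite substM downG; case: (iJ) => _ _;
    apply; exact: mem_gen.
- by move=> p _; exists (subst up p) => //; rewrite downupK subrr; case: iJ.
Qed.

End AffineBezout.

(** * Local multiplicities *)

Section Idempotents.
Context (C : closedFieldType) (n : nat).
Local Notation P := {mpoly C[n]}.
Implicit Types (I : P -> Prop) (f g u : P) (p q v : 'rV[C]_n).

Lemma separate_points p q : p != q -> exists f, f.@[p 0] = 1 /\ f.@[q 0] = 0.
Proof.
move=> pq; have [i pqi] : exists i, p 0 i != q 0 i.
  apply: contrapT => h; move/negP: pq; apply; apply/eqP/rowP => i.
  by apply: contrapT => /eqP h'; apply: h; exists i.
rewrite -subr_eq0 in pqi; exists ((p 0 i - q 0 i)^-1 *: ('X_i - (q 0 i)%:MP)).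
by rewrite !mevalZ !mevalB !mevalXU !mevalC subrr mulr0 mulVf.
Qed.

Lemma separate_from_list p (s : seq 'rV[C]_n) :
  exists f, f.@[p 0] = 1 /\ forall q, q \in s -> q != p -> f.@[q 0] = 0.
Proof.
elim: s => [|q s [f [fp fs]]]; first by exists 1; rewrite meval1.
have [->|pq] := eqVneq q p.
  by exists f; split=> // v; rewrite inE => /orP[/eqP ->|/fs//]; rewrite eqxx.
rewrite eq_sym in pq; have [g [gp gq]] := separate_points pq.
exists (f * g); rewrite mevalM fp gp mulr1; split=> // v.
rewrite inE mevalM => /orP[/eqP -> _|vs vp]; first by rewrite gq mulr0.
by rewrite (fs v) ?mul0r.
Qed.

(** An interpolating [u], 1 at [p] and 0 at the other points, is idempotent on the zeros; so
    [u * (1 - u)] is nilpotent modulo [I], and [u] can be corrected to an idempotent with the same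
    values. *)
Lemma lift_idempotent I (s : seq 'rV[C]_n) p : ideal I -> finite_codim I ->
  (forall v, is_zero I v -> v \in s) ->
  exists f, [/\ I (f * f - f), f.@[p 0] = 1 & forall q, q \in s -> q != p -> f.@[q 0] = 0].
Proof.
move=> iI fI zs; have [u [up us]] := separate_from_list p s.
have [v /zs vs|k Ik] := zero_nilpotent (u := u * (1 - u)) iI fI.
  rewrite mevalM mevalB meval1; have [->|vp] := eqVneq v p.
    by rewrite up subrr mulr0.
  by rewrite us ?mul0r.
(* Fulton's lift: [1 - (1 - x^k)^k] is divisible by [x^k], its complement by [(1 - x)^k]. *)
pose y := u ^+ k.+1; pose f := 1 - (1 - y) ^+ k.+1.
exists f; split.
- have /(congr1 (fun w => 1 * w)) := subrX1 (1 - y) k.+1.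
  have /(congr1 (fun w => 1 * w)) := subrX1 u k.+1.
  set a := \sum_(_ < _) _; set b := \sum_(_ < _) _ => Ea Eb.
  have fE : f = y * b by rewrite /f -opprB -[_ - 1]mul1r Eb; ring.
  have yE : 1 - y = (1 - u) * a by rewrite /y -opprB -[_ - 1]mul1r Ea; ring.
  have -> : f * f - f = - (a ^+ k.+1 * b * u * (1 - u)) * (u * (1 - u)) ^+ k.
    have -> : f * f - f = - (f * (1 - f)) by ring.
    rewrite {2}/f opprB addrC subrK fE yE /y !exprMn !exprS; ring.
  by case: iI => _ _; apply.
- by rewrite /f /y rmorphB rmorph1 rmorphXn rmorphB rmorph1 rmorphXn /= up expr1n subrr expr0n subr0.
- move=> q qs qp; rewrite /f /y rmorphB rmorph1 rmorphXn rmorphB rmorph1 rmorphXn /= us //.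
  by rewrite expr0n subr0 expr1n subrr.
Qed.

Lemma idempotent_no_zero I u : ideal I -> finite_codim I -> I (u * u - u) ->
  (forall v, is_zero I v -> u.@[v 0] = 0) -> I u.
Proof.
move=> iI fI idu zu; have [k Ik] := zero_nilpotent iI fI zu; have [I0 ID IM] := iI.
have h j : I (u ^+ j.+1 - u).
  elim: j => [|j IH]; first by rewrite expr1 subrr.
  have -> : u ^+ j.+2 - u = u * (u ^+ j.+1 - u) + (u * u - u) by rewrite [u ^+ j.+2]exprS; ring.
  by apply: ID => //; exact: IM.
have -> : u = u * u ^+ k - (u ^+ k.+1 - u) by rewrite exprS; ring.
by apply: ideal_sub => //; exact: IM.
Qed.

Lemma sum_idempotent I (T : eqType) (s : seq T) (e : T -> P) : ideal I -> uniq s ->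
  {in s, forall x, I (e x * e x - e x)} ->
  {in s &, forall x y, x != y -> I (e x * e y)} ->
  I ((\sum_(x <- s) e x) * (\sum_(x <- s) e x) - \sum_(x <- s) e x).
Proof.
move=> iI us ide orth; have [_ ID _] := iI.
rewrite {1}mulr_suml -sumrB big_seq; apply: ideal_sum => // x xs.
rewrite big_distrr (bigD1_seq x) //= addrAC; apply: ID; first exact: ide.
rewrite big_seq_cond; apply: ideal_sum => // y /andP[ys yx].
by apply: orth; rewrite // eq_sym.
Qed.

(** [I (e x * f)] says that [f] is killed by [e x] modulo [I], so the polynomials modulo this
    condition are the component cut out by [e x]; components of orthogonal idempotents add up. *)
Lemma has_dim_idempotents I (T : eqType) (s : seq T) (e : T -> P) (mu : T -> nat) :
  ideal I -> uniq s -> {in s, forall x, I (e x * e x - e x)} ->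
  {in s &, forall x y, x != y -> I (e x * e y)} ->
  {in s, forall x, has_dim whole (fun f => I (e x * f)) (mu x)} ->
  has_dim whole (fun f => I ((\sum_(x <- s) e x) * f)) (\sum_(x <- s) mu x).
Proof.
move=> iI; have [I0 ID IM] := iI.
have iQ := fun a => ideal_quotient a iI.
elim: s => [|p s IH] /=.
  move=> _ _ _ _; rewrite !big_nil.
  apply: (has_dim_eq (U := whole) (W := whole)) => [//|f|]; last exact: has_dim0.
  by rewrite mul0r.
case/andP=> ps us ide orth dp.
have sub (q : T) : q \in s -> q \in p :: s by rewrite inE orbC => ->.
have {}IH := IH us (sub_in1 sub ide) (sub_in2 sub orth) (sub_in1 sub dp).
rewrite !big_cons addnC; set E := \sum_(q <- s) e q in IH *.
have Ep : I (e p * E).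
  rewrite /E big_distrr /= big_seq; apply: ideal_sum => // q qs.
  by apply: orth; rewrite ?mem_head ?sub //; apply: contraNneq ps => ->.
have EE : I (E * E - E) by exact: sum_idempotent iI us (sub_in1 sub ide) (sub_in2 sub orth).
have idp : I (e p * e p - e p) by apply: ide; rewrite mem_head.
apply: (has_dimD (W := fun f => I (E * f))) IH _ => //.
- exact/ideal_subspace.
- move=> f If; have -> : E * f = (E * ((e p + E) * f) - f * (e p * E)) - f * (E * E - E) by ring.
  by apply: ideal_sub => //; [apply: ideal_sub => //|]; exact: IM.
- exact/ideal_subspace.
apply: (has_dim_transport (phi := fun f => e p * f)) (dp p (mem_head _ _)) => //.
- by move=> c u v; rewrite mulrDr scalerAr.
- exact/ideal_subspace.
- by move=> u _; rewrite mulrA mulrC [E * _]mulrC; exact: IM.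
- move=> u _; have Ei : I ((e p + E) * (e p * u) - e p * u).
    have -> : (e p + E) * (e p * u) - e p * u = u * (e p * e p - e p) + u * (e p * E) by ring.
    by apply: ID; exact: IM.
  split=> h; last exact: ideal_subl Ei h.
  by rewrite -[e p * u](subKr ((e p + E) * (e p * u))); apply: ideal_sub.
- move=> f If; exists f => //.
  have -> : (e p + E) * (f - e p * f) = E * f - f * (e p * E) - f * (e p * e p - e p) by ring.
  by apply: ideal_sub => //; [apply: ideal_sub => //|]; exact: IM.
Qed.

End Idempotents.

(** * Identities for use in the field of fractions *)

Section FieldIdentities.
Context (F : fieldType).

Lemma clear_denominator (x y z w : F) : x != 0 -> x * y * (z / x * w) = z * y * w.
Proof. by move=> x0; field. Qed.

Lemma sub_fraction (h d t : F) : d != 0 -> h / d - h * t = d^-1 * (h * (1 - t * d)).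
Proof. by move=> d0; field. Qed.

Lemma sub_fraction1 (h d c : F) : d != 0 -> h / d - c = d^-1 * (h - c * d).
Proof. by move=> d0; field. Qed.

Lemma telescope3 (x y z w : F) : z - y = (x - w) + (w - y) - (x - z).
Proof. by ring. Qed.

End FieldIdentities.

Section LocalMultiplicity.
Context (R : realType) (n : nat).
Local Notation C := R[i].
Local Notation P := {mpoly C[n]}.
Local Notation Frac := {fraction P}.
Local Notation "x %:F" := (@FracField.tofrac P x).
Implicit Types (f h u : P) (p : 'rV[C]_n) (g : 'I_n -> P).

Lemma tofrac_inj : injective (fun f : P => f%:F).
Proof. by move=> x y /eqP; rewrite tofrac_eq => /eqP. Qed.

Lemma meval_neq0 h p : h.@[p 0] != 0 -> h%:F != 0.
Proof. by rewrite tofrac_eq0; apply: contraNneq => ->; rewrite meval0. Qed.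

Lemma local_ring_tofrac p f : local_ring p f%:F.
Proof. by exists f, 1; rewrite meval1 oner_neq0 tofrac1 divr1. Qed.

Lemma local_ringV p h : h.@[p 0] != 0 -> local_ring p (h%:F)^-1.
Proof. by move=> hp; exists 1, h; rewrite tofrac1 mul1r. Qed.

Lemma local_ringM p (r1 r2 : Frac) : local_ring p r1 -> local_ring p r2 ->
  local_ring p (r1 * r2).
Proof.
move=> [h1 [s1 [s1p ->]]] [h2 [s2 [s2p ->]]]; exists (h1 * h2), (s1 * s2).
by rewrite mevalM mulf_neq0 // !tofracM mulf_div.
Qed.

Lemma local_ringD p (r1 r2 : Frac) : local_ring p r1 -> local_ring p r2 ->
  local_ring p (r1 + r2).
Proof.
move=> [h1 [s1 [s1p ->]]] [h2 [s2 [s2p ->]]]; exists (h1 * s2 + h2 * s1), (s1 * s2).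
rewrite mevalM mulf_neq0 //; split=> //.
rewrite (addf_div _ _ (meval_neq0 s1p) (meval_neq0 s2p)).
by rewrite tofracD (tofracM h1) (tofracM h2) (tofracM s1).
Qed.

Lemma local_idealD g p (r1 r2 : Frac) :
  local_ideal g p r1 -> local_ideal g p r2 -> local_ideal g p (r1 + r2).
Proof.
move=> [a [la ->]] [b [lb ->]]; exists (fun i => a i + b i); split.
  by move=> i; exact: local_ringD.
by rewrite -big_split; apply: eq_bigr => i _; rewrite mulrDl.
Qed.

Lemma local_idealM g p (r1 r2 : Frac) :
  local_ring p r1 -> local_ideal g p r2 -> local_ideal g p (r1 * r2).
Proof.
move=> lr [a [la ->]]; exists (fun i => r1 * a i); split.
  by move=> i; exact: local_ringM.
by rewrite mulr_sumr; apply: eq_bigr => i _; rewrite mulrA.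
Qed.

Lemma local_idealB g p (r1 r2 : Frac) :
  local_ideal g p r1 -> local_ideal g p r2 -> local_ideal g p (r1 - r2).
Proof.
move=> h1 h2; apply: local_idealD => //; rewrite -mulN1r -tofrac1 -tofracN.
by apply: local_idealM => //; exact: local_ring_tofrac.
Qed.

Lemma gen_local_ideal g p f : gen [set: 'I_n] g f -> local_ideal g p f%:F.
Proof.
move=> [u ->]; exists (fun i => (u i)%:F); split=> [i|].
  exact: local_ring_tofrac.
rewrite raddf_sum; apply: eq_big => [i|i _]; first by rewrite inE.
by rewrite /= tofracM.
Qed.

(** Multiply by the product of the denominators, which does not vanish at [p]. *)
Lemma local_ideal_gen g p f : local_ideal g p f%:F ->
  exists2 h, h.@[p 0] != 0 & gen [set: 'I_n] g (h * f).
Proof.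
move=> [a [la E]].
have [num hn] := choice la; have [den hd] := choice hn.
pose co i := \prod_(j | j != i) den j.
exists (\prod_i den i).
  by rewrite rmorph_prod; apply/prodf_neq0 => i _; case: (hd i).
exists (fun i => num i * co i); apply: tofrac_inj => /=.
rewrite tofracM E mulr_sumr raddf_sum; apply: eq_big => [i|i _]; first by rewrite inE.
have [di ->] := hd i; rewrite (bigD1 i) //= -/(co i) !tofracM.
apply: clear_denominator (meval_neq0 di).
Qed.

Lemma local_ideal_meval g p f : (forall i, (g i).@[p 0] = 0) ->
  local_ideal g p f%:F -> f.@[p 0] = 0.
Proof.
move=> gp /local_ideal_gen[h hp [u E]]; apply: (mulfI hp); rewrite mulr0 -mevalM E.
by rewrite raddf_sum big1 // => i _; rewrite /= mevalM gp mulr0.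
Qed.

Lemma tofrac_lincomb r (c : 'rV_r) (b : 'I_r -> P) :
  \sum_j ((c 0 j)%:MP)%:F * (b j)%:F = (lincomb c b)%:F.
Proof.
by rewrite raddf_sum; apply: eq_bigr => j _; rewrite -tofracM mul_mpolyC.
Qed.

(** The local ring at [p] modulo the ideal is the component of [e]: an [h] with [h(p)] nonzero is
    invertible there, because [p] is the only possible zero of [I] and [1 - e] together. *)
Lemma local_multiplicity g (s : seq 'rV[C]_n) p (e : P) mu :
  let I := gen [set: 'I_n] g in finite_codim I ->
  (forall v, is_zero I v -> v \in s) -> p \in s ->
  I (e * e - e) -> e.@[p 0] = 1 -> (forall q, q \in s -> q != p -> e.@[q 0] = 0) ->
  has_dim whole (fun f => I (e * f)) mu -> has_zero_multiplicity g p mu.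
Proof.
move=> I fI zs ps ide ep es [b [_ sb fb]].
have iI : ideal I by exact: ideal_gen.
have [I0 ID IM] := iI.
have ep0 : e.@[p 0] != 0 by rewrite ep oner_neq0.
have unit_at h : h.@[p 0] != 0 -> exists t, I (e * (1 - t * h)).
  move=> hp; have fI' : finite_codim (add_gen I (1 - e)).
    by apply: finite_codim_sub fI => f; exact: sub_add_gen.
  have [v zv|j [t [[i [w [Ii ->]]] one]]] := zero_free_unit (u := h) (ideal_add_gen _ iI) fI'.
    suff -> : v = p by exact/eqP.
    apply: contrapT => /eqP vp; have := zv _ (gen_add_gen _ iI).
    rewrite mevalB meval1 es ?subr0 //; first by move/eqP; rewrite oner_eq0.
    by apply: zs => f If; apply: zv; exact: sub_add_gen.
  exists t; have -> : e * (1 - t * h) = e * i - w * (e * e - e).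
    by rewrite [X in e * (X - _)]one; ring.
  by apply: ideal_sub => //; exact: IM.
have localP f : local_ideal g p f%:F <-> I (e * f).
  split=> [/local_ideal_gen[h hp Ihf]|Ief].
    have [t It] := unit_at _ hp.
    have -> : e * f = f * (e * (1 - t * h)) + e * t * (h * f) by ring.
    by apply: ID; exact: IM.
  rewrite -[f%:F](mulKf (meval_neq0 ep0)) -tofracM.
  by apply: local_idealM; [exact: local_ringV|exact: gen_local_ideal].
exists (fun j => (b j)%:F); split=> [j|r]; first exact: local_ring_tofrac.
(* With [t] an inverse of [d] on the component of [e], the fraction [h / d] is represented by the
   polynomial [t * h]. *)
move=> [h [d [dp ->]]]; have [t It] := unit_at _ dp.
have [c Ic] := sb (t * h) Logic.I.
have d0 := meval_neq0 dp.
have rE : local_ideal g p (h%:F / d%:F - (t * h)%:F).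
  have -> : h%:F / d%:F - (t * h)%:F = (d%:F)^-1 * (h * (1 - t * d))%:F.
    rewrite (tofracM t h) (tofracM h (1 - t * d)) tofracB tofrac1 (tofracM t d) [t%:F * h%:F]mulrC.
    exact: sub_fraction.
  apply: local_idealM; first exact: local_ringV.
  by apply/localP; rewrite mulrCA; exact: IM.
exists c; split=> [|c' Ic'].
  rewrite tofrac_lincomb -[h%:F / d%:F](subrK (t * h)%:F) -addrA -tofracB.
  by apply: local_idealD => //; apply/localP.
rewrite tofrac_lincomb in Ic'.
have : local_ideal g p (lincomb (c' - c) b)%:F.
  have -> : (lincomb (c' - c) b)%:F = (h%:F / d%:F - (t * h)%:F) +
     (t * h - lincomb c b)%:F - (h%:F / d%:F - (lincomb c' b)%:F).
    rewrite lincombD lincombN tofracD tofracN tofracB; exact: telescope3.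
  by apply: local_idealB => //; apply: local_idealD => //; apply/localP.
by move=> /localP/fb/eqP; rewrite subr_eq0 => /eqP.
Qed.

Lemma zero_multiplicities g N : has_dim whole (gen [set: 'I_n] g) N ->
  exists (s : seq 'rV[C]_n) (mu : 'rV[C]_n -> nat),
    [/\ uniq s, forall v : 'rV[C]_n, (forall i, (g i).@[v 0] = 0) <-> v \in s,
        forall v : 'rV[C]_n, v \in s -> has_zero_multiplicity g v (mu v) &
        (\sum_(v <- s) mu v)%N = N].
Proof.
move=> dN; set I := gen _ _ in dN; have iI : ideal I by exact: ideal_gen.
have fI := has_dim_finite_codim dN; have [s us sP] := finite_zeros iI fI.
have [I0 ID IM] := iI.
have zs v : is_zero I v -> v \in s by move/sP.
have [e he] := choice (fun p => lift_idempotent p iI fI zs).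
have iQ := fun a => ideal_quotient a iI.
have dQ p : exists m, has_dim whole (fun f => I (e p * f)) m.
  apply: finite_codim_has_dim => //; apply: finite_codim_sub fI => f; exact: IM.
have [mu hmu] := choice dQ; exists s, mu; split=> //.
- move=> v; split=> [gv|/sP zv i]; last by apply: zv; exact: mem_gen.
  apply/sP => f [u ->]; rewrite raddf_sum big1 // => i _.
  by rewrite /= mevalM gv mulr0.
- by move=> p ps; have [ide ep es] := he p;
  exact: local_multiplicity fI zs ps ide ep es (hmu p).
(* The product is idempotent modulo [I] and vanishes at every zero, hence lies in [I]; the same
   argument applied to [1 - E] shows that the components exhaust the quotient. *)
have orth : {in s &, forall x y, x != y -> I (e x * e y)}.
  move=> p q ps qs pq; have [idp ep ezp] := he p; have [idq eq ezq] := he q.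
  apply: idempotent_no_zero => // [|v /sP vs].
    have -> : e p * e q * (e p * e q) - e p * e q =
      e q * e q * (e p * e p - e p) + e p * (e q * e q - e q) by ring.
    by apply: ID; exact: IM.
  rewrite mevalM; have [->|vp] := eqVneq v p; first by rewrite ezq ?mulr0.
  by rewrite ezp ?mul0r.
have ide : {in s, forall x, I (e x * e x - e x)} by move=> p _; case: (he p).
have ds := has_dim_idempotents iI us ide orth (fun p _ => hmu p).
apply: (has_dim_uniq (ideal_subspace (iQ _)) ds).
apply: has_dim_eq dN => // f; set E := \sum_(x <- s) e x.
have IE : I (1 - E).
  apply: idempotent_no_zero => // [|v /sP vs]; last first.
    have -> : (1 - E).@[v 0] = 1 - \sum_(q <- s) (e q).@[v 0].
      by rewrite mevalB meval1; congr (_ - _); exact: raddf_sum.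
    rewrite (bigD1_seq v) //=; have [_ -> _] := he v;
      rewrite big_seq_cond big1 ?addr0 ?subrr // => q /andP[qs qv].
    by have [_ _ ->] := he q; rewrite // eq_sym.
  have -> : (1 - E) * (1 - E) - (1 - E) = E * E - E by ring.
  exact: sum_idempotent iI us ide orth.
split=> [If|IEf]; first exact: IM.
have -> : f = f * (1 - E) + E * f by ring.
by apply: ID => //; exact: IM.
Qed.

Lemma homog_linear_coefficients h D : h \is D.-homog -> (1 < D)%N ->
  exists a : 'I_n -> P, (forall j, (a j).@[(0 : 'rV[C]_n) 0] = 0) /\ h = \sum_j a j * 'X_j.
Proof.
move=> /dhomogP hh D1.
pose Q f := exists a : 'I_n ->
  P, (forall j, (a j).@[(0 : 'rV[C]_n) 0] = 0) /\ f = \sum_j a j * 'X_j.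
have QD f1 f2 : Q f1 -> Q f2 -> Q (f1 + f2).
  move=> [a [a0 ->]] [b [b0 ->]]; exists (fun j => a j + b j); split.
    by move=> j; rewrite mevalD a0 b0 addr0.
  by rewrite -big_split; apply: eq_bigr => j _; rewrite mulrDl.
rewrite [h]mpolyE big_seq; elim/big_ind: _ => //.
  by exists (fun=> 0); split=> [j|]; rewrite ?meval0 // big1 // => j _; rewrite mul0r.
move=> m /hh /= md; have [j mj] : exists j, m j != 0%N.
  apply: contrapT => nz; move: D1; rewrite -md mdegE big1 // => i _.
  by apply/eqP/negPn/negP => mi; apply: nz; exists i.
(* The monomial is divided by a variable occurring in it; the quotient still has positive degree
   [D - 1], so it vanishes at 0. *)
exists (fun k => if k == j then h@_m *: 'X_[m - U_(j)] else 0); split.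
  move=> k; case: eqP => _; last by rewrite meval0.
  rewrite mevalZ mevalX; have [i mi] : exists i, (m - U_(j))%MM i != 0%N.
    apply: contrapT => nz; have : mdeg (m - U_(j))%MM = 0%N.
      rewrite mdegE big1 // => i _; apply/eqP/negPn/negP => mi; apply: nz; by exists i.
    have : mdeg ((m - U_(j)) + U_(j))%MM = D.
      rewrite submK ?md //; apply/mnm_lepP => i; rewrite mnm1E.
      by case: eqP => // <-; rewrite lt0n.
    by rewrite mdegD mdeg1 => DE E; move: D1; rewrite -DE E.
  by rewrite (bigD1 i) //= mxE expr0n (negbTE mi) mul0r mulr0.
rewrite (bigD1 j) //= eqxx big1 ?addr0 => [|k /negbTE ->]; last by rewrite mul0r.
rewrite -scalerAl -mpolyXD submK //; apply/mnm_lepP => i; rewrite mnm1E.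
by case: eqP => // <-; rewrite lt0n.
Qed.

Lemma multiplicity_one_at_origin (h : 'I_n -> P) D :
  (forall i, h i \is D.-homog) -> (1 < D)%N ->
  has_zero_multiplicity (fun i => h i - 'X_i) 0 1.
Proof.
move=> hh D1; set g := fun i => _.
have [a ha] := choice (fun i => homog_linear_coefficients (hh i) D1).
pose B := \matrix_(i, j) a i j - 1%:M : 'M[P]_n.
have Bg : B *m (\col_j 'X_j) = \col_i g i.
  apply/colP => i; rewrite mulmxBl mul1mx !mxE /g; have [_ {1}->] := ha i.
  by congr (_ - _); apply: eq_bigr => j _; rewrite !mxE.
(* At the origin [B] is minus the identity, so its determinant is a unit of the local ring. *)
have detB : (\det B).@[(0 : 'rV[C]_n) 0] != 0.
  rewrite -[X in X != _]/(meval _ _) -det_map_mx.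
  have -> : map_mx (meval ((0 : 'rV[C]_n) 0)) B = - 1%:M.
    apply/matrixP => i j; rewrite !mxE mevalB; have [-> _] := ha i.
    by rewrite rmorph_nat sub0r.
  by rewrite -scaleN1r detZ det1 mulr1 signr_eq0.
have Xj j : local_ideal g 0 ('X_j)%:F.
  rewrite -[('X_j)%:F](mulKf (meval_neq0 detB)) -tofracM.
  apply: local_idealM; first exact: local_ringV.
  apply: gen_local_ideal; have : \adj B *m (\col_i g i) = \det B *: \col_j 'X_j.
    by rewrite -Bg mulmxA mul_adj_mx mul_scalar_mx.
  move=> /colP/(_ j); rewrite !mxE => <-; apply: ideal_sum => [|i _].
    exact: ideal_gen.
  have [_ _ IM] := ideal_gen [set: 'I_n] g; apply: IM.
  by rewrite mxE; exact: (@mem_gen _ _ _ _ g).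
have vanish f : f.@[(0 : 'rV[C]_n) 0] = 0 -> local_ideal g 0 f%:F.
  move=> f0; have := @meval_congr C n (gen [set: 'I_n] (fun i => 'X_i))
    ((0 : 'rV[C]_n) 0) f (ideal_gen _ _).
  case=> [i|u]; first by rewrite mxE subr0; exact: (@mem_gen _ _ _ _ (fun i => 'X_i)).
  rewrite f0 subr0 => ->; rewrite raddf_sum.
  elim/big_ind: _ => [|x y|j _]; [by exists (fun=> 0); split=> [i|]; [rewrite -tofrac0;
    exact: local_ring_tofrac|rewrite big1 // => i _; rewrite mul0r]|exact: local_idealD|].
  by rewrite /= tofracM; apply: local_idealM => //; exact: local_ring_tofrac.
have g0 i : (g i).@[(0 : 'rV[C]_n) 0] = 0.
  have [a0 E] := ha i; rewrite mevalB mevalXU mxE subr0 E raddf_sum big1 // => j _.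
  by rewrite /= mevalM a0 mul0r.
exists (fun=> 1); split=> [_|r]; first by rewrite -tofrac1; exact: local_ring_tofrac.
move=> [f [d [d0 ->]]]; pose c := f.@[(0 : 'rV[C]_n) 0] / d.@[(0 : 'rV[C]_n) 0].
have sumE (c' : 'rV[C]_1) : \sum_j ((c' 0 j)%:MP)%:F * 1 = ((c' 0 0)%:MP)%:F :> Frac.
  by rewrite big_ord_recl big_ord0 addr0 mulr1.
have dF := meval_neq0 d0.
have Lc : local_ideal g 0 (f%:F / d%:F - (c%:MP)%:F).
  have -> : f%:F / d%:F - (c%:MP)%:F = (d%:F)^-1 * (f - c%:MP * d)%:F.
    by rewrite tofracB tofracM; exact: sub_fraction1.
  apply: local_idealM; first exact: local_ringV.
  by apply: vanish; rewrite mevalB mevalM mevalC divfK // subrr.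
exists (\row_j c); split=> [|c']; rewrite sumE ?mxE // => Lc'.
have := local_idealB Lc Lc'; rewrite opprB addrC addrA subrK -tofracB -mpolyCB.
move=> /(local_ideal_meval g0); rewrite mevalC => /eqP; rewrite subr_eq0 => /eqP E.
by apply/rowP => j; rewrite ord1 mxE E.
Qed.

End LocalMultiplicity.

(** * Banach's theorem on symmetric multilinear forms *)

Section Compactness.
Context (R : realType) (d n : nat).
Local Notation C := R[i].
Local Notation coords := 'rV[R]_#|{: 'I_d * 'I_n * bool}|.
Implicit Types (Q : ('I_d -> 'rV[C]_n) -> Prop) (G : ('I_d -> 'rV[C]_n) -> C).

(** Tuples of complex vectors are encoded as one real row vector, real and imaginary parts
    separately, so that compactness of a box in real coordinates applies. *)
Definition decode (v : coords) : 'I_d -> 'rV[C]_n := fun k =>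
  \row_j Complex (v 0 (enum_rank (k, j, false))) (v 0 (enum_rank (k, j, true))).

Definition encode (x : 'I_d -> 'rV[C]_n) : coords :=
  \row_i let: (k, j, b) := enum_val i in
         if b then complex.Im (x k 0 j) else complex.Re (x k 0 j).

Lemma encodeK x : decode (encode x) = x.
Proof.
by apply/funext => k; apply/rowP => j; rewrite !mxE !enum_rankK; case: (x k 0 j).
Qed.

Definition continuous_form G :=
  continuous (fun v : coords => complex.Re (G (decode v))) /\
  continuous (fun v : coords => complex.Im (G (decode v))).

Definition closed_condition Q := closed [set v : coords | Q (decode v)]%classic.

Lemma continuous_form_const c : continuous_form (fun=> c).
Proof. by split=> v; exact: cst_continuous. Qed.

Lemma continuous_form_coord k j : continuous_form (fun x => x k 0 j).
Proof.
by split; under [X in continuous X]funext do rewrite mxE /=; exact: coord_continuous.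
Qed.

Lemma continuous_formD G1 G2 : continuous_form G1 -> continuous_form G2 ->
  continuous_form (fun x => G1 x + G2 x).
Proof.
move=> [r1 i1] [r2 i2]; split; under [X in continuous X]funext => v.
- rewrite (_ : complex.Re _ = complex.Re (G1 (decode v)) + complex.Re (G2 (decode v)));
  last first.
    by case: (G1 _) => ? ?; case: (G2 _).
  over.
- by move=> v; exact: continuousD (r1 v) (r2 v).
- rewrite (_ : complex.Im _ = complex.Im (G1 (decode v)) + complex.Im (G2 (decode v)));
  last first.
    by case: (G1 _) => ? ?; case: (G2 _).
  over.
- by move=> v; exact: continuousD (i1 v) (i2 v).
Qed.

Lemma continuous_formM G1 G2 : continuous_form G1 -> continuous_form G2 ->
  continuous_form (fun x => G1 x * G2 x).
Proof.
move=> [r1 i1] [r2 i2]; split; under [X in continuous X]funext => v.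
- rewrite (_ : complex.Re _ = complex.Re (G1 (decode v)) * complex.Re (G2 (decode v))
                     - complex.Im (G1 (decode v)) * complex.Im (G2 (decode v))); last first.
    by case: (G1 _) => ? ?; case: (G2 _).
  over.
- by move=> v; exact: continuousB (continuousM (r1 v) (r2 v)) (continuousM (i1 v) (i2 v)).
- rewrite (_ : complex.Im _ = complex.Re (G1 (decode v)) * complex.Im (G2 (decode v))
                     + complex.Im (G1 (decode v)) * complex.Re (G2 (decode v))); last first.
    by case: (G1 _) => ? ?; case: (G2 _).
  over.
- by move=> v; exact: continuousD (continuousM (r1 v) (i2 v)) (continuousM (i1 v) (r2 v)).
Qed.

Lemma continuous_formJ G : continuous_form G -> continuous_form (fun x => (G x)^*).
Proof.
move=> [r i]; split; under [X in continuous X]funext => v.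
- rewrite (_ : complex.Re _ = complex.Re (G (decode v))); last by case: (G _).
  over.
- exact: r.
- rewrite (_ : complex.Im _ = - complex.Im (G (decode v))); last by case: (G _).
  over.
- by move=> v; exact: continuousN (i v).
Qed.

Lemma continuous_form_sum (I : Type) (r : seq I) (P : pred I) (G : I -> ('I_d ->
  'rV[C]_n) -> C) :
  (forall i, continuous_form (G i)) -> continuous_form (fun x => \sum_(i <- r | P i) G i x).
Proof.
move=> cG; elim: r => [|i r IH].
  by under [X in continuous_form X]funext do rewrite big_nil; exact: continuous_form_const.
under [X in continuous_form X]funext do rewrite big_cons.
by case: (P i) => //; exact: continuous_formD.
Qed.

Lemma continuous_form_prod (I : Type) (r : seq I) (P : pred I) (G : I -> ('I_d ->
  'rV[C]_n) -> C) :
  (forall i, continuous_form (G i)) -> continuous_form (fun x => \prod_(i <- r | P i) G i x).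
Proof.
move=> cG; elim: r => [|i r IH].
  by under [X in continuous_form X]funext do rewrite big_nil; exact: continuous_form_const.
under [X in continuous_form X]funext do rewrite big_cons.
by case: (P i) => //; exact: continuous_formM.
Qed.

Lemma closed_condition_eq G c : continuous_form G -> closed_condition (fun x => G x = c).
Proof.
move=> [r i]; rewrite /closed_condition.
rewrite (_ : mkset _ = (fun v => complex.Re (G (decode v))) @^-1` [set x | x = complex.Re c] `&`
                       (fun v => complex.Im (G (decode v))) @^-1` [set x | x = complex.Im c])%classic.
  apply: closedI; [move/continuous_closedP: r|move/continuous_closedP: i]; apply;
    exact: closed_eq.
apply/seteqP; split=> v /= => [->//|[]].
by case: (G _) => a b; case: c => a' b' /= -> ->.
Qed.

Lemma closed_condition_ge0 G : continuous_form G -> closed_condition (fun x => 0 <= G x).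
Proof.
move=> [r i]; rewrite /closed_condition.
rewrite (_ : mkset _ = (fun v => complex.Re (G (decode v))) @^-1` [set x | 0 <= x] `&`
                       (fun v => complex.Im (G (decode v))) @^-1` [set x | x = 0])%classic.
  apply: closedI; [move/continuous_closedP: r|move/continuous_closedP: i]; apply.
    exact: closed_ge.
  exact: closed_eq.
by apply/seteqP; split=> v /=; rewrite lecE /=; [move=> /andP[/eqP ->]|case=> -> ->;
  rewrite eqxx].
Qed.

Lemma closed_condition_and Q1 Q2 : closed_condition Q1 -> closed_condition Q2 ->
  closed_condition (fun x => Q1 x /\ Q2 x).
Proof. exact: closedI. Qed.

Lemma closed_condition_forall (I : Type) (Q : I -> ('I_d -> 'rV[C]_n) -> Prop) :
  (forall i, closed_condition (Q i)) -> closed_condition (fun x => forall i, Q i x).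
Proof.
move=> cQ; rewrite /closed_condition.
rewrite (_ : mkset _ = \bigcap_(i in setT) [set v : coords | Q i (decode v)])%classic.
  by apply: closed_bigI => i _; exact: cQ.
by apply/seteqP; split=> v h i; [move=> _|]; exact: h.
Qed.

(** Values are compared by their real parts; in the applications [G] is real on [Q], so this is its
    full order. *)
Lemma exists_max Q G : closed_condition Q -> continuous_form G -> (exists x, Q x) ->
  (forall x, Q x -> forall k j, `|complex.Re (x k 0 j)| <= 1 /\ `|complex.Im (x k 0 j)| <= 1) ->
  exists2 x, Q x & forall y, Q y -> complex.Re (G y) <= complex.Re (G x).
Proof.
move=> cQ [rG _] [x0 Qx0] bQ.
pose A := [set v : coords | Q (decode v)]%classic.
have A0 : (A !=set0)%classic by exists (encode x0); rewrite /A /= encodeK.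
have cA : compact A.
  have cbox := @rV_compact R _ (fun _ : 'I_#|{: 'I_d * 'I_n * bool}| => `[(-1), 1]%classic)
    (fun=> @segment_compact R (-1) 1).
  apply: subclosed_compact cQ cbox _ => v /= Qv i; rewrite in_itv /= -ler_norml.
  rewrite -(enum_valK i); case: (enum_val i) => [[k j] b].
  by have := bQ _ Qv k j; rewrite !mxE /=; case: b => -[].
have [|c /set_mem Ac cmax] := compact_EVT_max (f := fun v => complex.Re (G (decode v))) A0 cA.
  exact: continuous_subspaceT.
exists (decode c) => // y Qy; rewrite -[y]encodeK; apply: cmax; apply/mem_set.
by rewrite /A /= encodeK.
Qed.

End Compactness.

(** * The Hermitian product over real or complex scalars *)

Section Hermitian.
Context (R : realType) (n : nat) (K : scalar_field).
Local Notation C := R[i].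
Implicit Types (x y u v w : 'rV[C]_n) (c z : C).

Definition hdot x y : C := \sum_j x 0 j * (y 0 j)^*.

Definition kvec x : Prop := x \is a mxOver (scalars K).

Lemma kvecP x : kvec x <-> forall j, x 0 j \in scalars K.
Proof. by split=> [/mxOverP h j|h]; [exact: h|apply/mxOverP => i j; rewrite ord1;
  exact: h]. Qed.

Lemma scalars_real z : z \is Num.real -> z \in scalars K.
Proof. by rewrite /scalars; case: K. Qed.

Lemma scalarsD z c : z \in scalars K -> c \in scalars K -> z + c \in scalars K.
Proof. by rewrite /scalars; case: K => //; exact: realD. Qed.

Lemma scalarsM z c : z \in scalars K -> c \in scalars K -> z * c \in scalars K.
Proof. by rewrite /scalars; case: K => //; exact: realM. Qed.

Lemma scalarsJ z : z \in scalars K -> z^* \in scalars K.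
Proof. by rewrite /scalars; case: K => // /= h; rewrite unfold_in /= conj_Creal. Qed.

Lemma scalars_sum I (r : seq I) (P : pred I) (F : I -> C) :
  (forall i, F i \in scalars K) -> \sum_(i <- r | P i) F i \in scalars K.
Proof.
by move=> h; elim/big_ind: _ => //; [exact/scalars_real/real0|exact: scalarsD].
Qed.

Lemma scalars_prod I (r : seq I) (P : pred I) (F : I -> C) :
  (forall i, F i \in scalars K) -> \prod_(i <- r | P i) F i \in scalars K.
Proof.
by move=> h; elim/big_ind: _ => //; [exact/scalars_real/real1|exact: scalarsM].
Qed.

Lemma kvecD x y : kvec x -> kvec y -> kvec (x + y).
Proof. by move=> /kvecP hx /kvecP hy; apply/kvecP => j; rewrite mxE; exact: scalarsD. Qed.

Lemma kvecZ c x : c \in scalars K -> kvec x -> kvec (c *: x).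
Proof. by move=> hc /kvecP hx; apply/kvecP => j; rewrite mxE; exact: scalarsM. Qed.

Lemma kvec_delta j : kvec (delta_mx 0 j).
Proof. by apply/kvecP => i; rewrite mxE; apply: scalars_real; rewrite realn. Qed.

Lemma hdotDl x y u : hdot (x + y) u = hdot x u + hdot y u.
Proof. by rewrite -big_split; apply: eq_bigr => j _; rewrite mxE mulrDl. Qed.

Lemma hdotZl c x u : hdot (c *: x) u = c * hdot x u.
Proof. by rewrite /hdot mulr_sumr; apply: eq_bigr => j _; rewrite mxE mulrA. Qed.

Lemma hdotJ x y : (hdot x y)^* = hdot y x.
Proof. by rewrite rmorph_sum; apply: eq_bigr => j _; rewrite rmorphM /= conjCK mulrC. Qed.

Lemma hdotDr x y u : hdot u (x + y) = hdot u x + hdot u y.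
Proof. by rewrite -hdotJ hdotDl rmorphD /= !hdotJ. Qed.

Lemma hdotZr c x u : hdot u (c *: x) = c^* * hdot u x.
Proof. by rewrite -hdotJ hdotZl rmorphM /= !hdotJ. Qed.

Lemma hdot_parallelogram x y :
  hdot (x + y) (x + y) + hdot (x - y) (x - y) = (hdot x x + hdot y y) *+ 2.
Proof.
rewrite /hdot -!big_split -sumrMnl; apply: eq_bigr => j _ /=.
by rewrite !mxE !rmorphD rmorphN /=; ring.
Qed.

Lemma hdot_ge0 x : 0 <= hdot x x.
Proof. by apply: sumr_ge0 => j _; rewrite -normCK exprn_ge0. Qed.

Lemma hdot_eq0 x : hdot x x = 0 -> x = 0.
Proof.
move/eqP; rewrite psumr_eq0 => [|j _]; last by rewrite -normCK exprn_ge0.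
move/allP => h; apply/rowP => j; rewrite mxE.
by apply/eqP; have := h j (mem_index_enum _); rewrite mulf_eq0 conjC_eq0 orbb.
Qed.

Lemma hdot_gt0 x : x != 0 -> 0 < hdot x x.
Proof.
by move=> x0; rewrite lt0r hdot_ge0 andbT; apply: contra x0 => /eqP/hdot_eq0/eqP.
Qed.

Lemma hdot_delta x j : hdot (delta_mx 0 j) x = (x 0 j)^*.
Proof.
rewrite /hdot (bigD1 j) //= big1 ?addr0 => [|i ij]; first by rewrite mxE !eqxx mul1r.
by rewrite mxE eqxx (negbTE ij) mul0r.
Qed.

Lemma normc_norm z : `|z| = (Normc.normc z)%:C%C.
Proof. by case: z => a b; rewrite normc_def. Qed.

Lemma hnorm_hdot x : (hnorm x ^+ 2)%:C%C = hdot x x.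
Proof.
rewrite /hnorm sqr_sqrtr; last by apply: sumr_ge0 => j _; exact: sqr_ge0.
rewrite rmorph_sum; apply: eq_bigr => j _; rewrite rmorphXn /= -normc_norm.
exact: normCK.
Qed.

Lemma hnorm_ge0 x : 0 <= hnorm x. Proof. exact: sqrtr_ge0. Qed.

Lemma hnorm1P x : hnorm x = 1 <-> hdot x x = 1.
Proof.
rewrite -hnorm_hdot; split=> [->|]; first by rewrite expr1n.
by move/complexI/eqP; rewrite sqrp_eq1 ?hnorm_ge0 // => /eqP.
Qed.

Lemma unit_normalized x : x != 0 ->
  hdot ((sqrtC (hdot x x))^-1 *: x) ((sqrtC (hdot x x))^-1 *: x) = 1.
Proof.
move=> x0; have N0 : sqrtC (hdot x x) != 0 by rewrite sqrtC_eq0 gt_eqF // hdot_gt0.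
have NR : (sqrtC (hdot x x))^-1 \is Num.real by rewrite ger0_real // invr_ge0 sqrtC_ge0 hdot_ge0.
rewrite hdotZl hdotZr conj_Creal // -[X in _ * (_ * X)]sqrtCK expr2.
by rewrite mulKf // mulVf.
Qed.

(* The equality case of the Cauchy-Schwarz inequality. *)
Lemma norm_attained v y (lam : C) : kvec v -> hdot y y = 1 ->
  (forall w, kvec w -> hdot w w = 1 -> `|\sum_j w 0 j * v 0 j| <= `|lam|) ->
  \sum_j y 0 j * v 0 j = lam -> forall j, v 0 j = lam * (y 0 j)^*.
Proof.
move=> kv y1 bound lamE.
have vle : hdot v v <= `|lam| ^+ 2.
  have [->|v0] := eqVneq v 0.
    by rewrite /hdot big1 ?exprn_ge0 // => j _; rewrite mxE mul0r.
  (* Normalized, the conjugate of [v] is the test vector at which the linear form takes the value of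
     the norm of [v]. *)
  pose w := conj_vec v; have ww : hdot w w = hdot v v.
    by apply: eq_bigr => j _; rewrite !mxE conjCK mulrC.
  have w0 : w != 0.
    by apply: contra v0 => /eqP w0; apply/eqP/hdot_eq0; rewrite -ww w0 /hdot big1 // => j _;
      rewrite mxE mul0r.
  have kw : kvec w by move/kvecP: kv => kv; apply/kvecP => j; rewrite mxE; exact: scalarsJ.
  have N0 : 0 <= sqrtC (hdot v v) by rewrite sqrtC_ge0 hdot_ge0.
  have := bound ((sqrtC (hdot w w))^-1 *: w); rewrite unit_normalized // => /(_ _ erefl).
  have -> : \sum_j ((sqrtC (hdot w w))^-1 *: w) 0 j * v 0 j = sqrtC (hdot v v).
    under eq_bigr do rewrite mxE -mulrA.
    rewrite -mulr_sumr ww; have -> : \sum_j w 0 j * v 0 j = hdot v v.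
      by apply: eq_bigr => j _; rewrite mxE mulrC.
    rewrite -[X in _ * X]sqrtCK expr2 mulKf //.
    by rewrite sqrtC_eq0 gt_eqF // hdot_gt0.
  move=> h; rewrite -[hdot v v]sqrtCK -[sqrtC _ in leLHS]ger0_norm //.
  rewrite ler_sqr ?nnegrE //; apply: h; apply: kvecZ => //; apply: scalars_real.
  by rewrite ger0_real // invr_ge0 ww.
(* The square of the distance from [v] to [lam] times the conjugate of [y] is the difference that
   [vle] shows to be nonpositive. *)
have : \sum_j `|v 0 j - lam * (y 0 j)^*| ^+ 2 = hdot v v - `|lam| ^+ 2.
  under eq_bigr do rewrite normCK rmorphB rmorphM /= conjCK.
  have -> : \sum_j (v 0 j - lam * (y 0 j)^*) * ((v 0 j)^* - lam^* * y 0 j) =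
    hdot v v - lam^* * (\sum_j y 0 j * v 0 j) - lam * (\sum_j y 0 j * v 0 j)^*
    + lam * lam^* * hdot y y.
    rewrite /hdot rmorph_sum !mulr_sumr -!sumrB -big_split; apply: eq_bigr => j _ /=.
    by rewrite rmorphM /=; ring.
  by rewrite lamE y1 normCK; ring.
move=> sumE; have sum_le0 : \sum_j `|v 0 j - lam * (y 0 j)^*| ^+ 2 <= 0.
  by rewrite sumE subr_le0.
have /eqP : \sum_j `|v 0 j - lam * (y 0 j)^*| ^+ 2 = 0.
  by apply/le_anti; rewrite sum_le0 sumr_ge0 // => j _; exact: exprn_ge0.
rewrite psumr_eq0 => [/allP h j|j _]; last exact: exprn_ge0.
have := h j (mem_index_enum _); rewrite sqrf_eq0 normr_eq0 subr_eq0.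
by move/eqP.
Qed.

End Hermitian.

(** * Diagonal maximizers of symmetric multilinear forms *)

Section Banach.
Context (R : realType) (d n : nat) (K : scalar_field) (S : tensor R d n).
Hypothesis symS : symmetric_tensor K S.
Local Notation C := R[i].
Local Notation vec := 'rV[R[i]]_n.
Local Notation tuples := ('I_d -> vec).
Local Notation T := (multilinear_form S).
Local Notation e_ j := (delta_mx 0 j : vec).
Implicit Types (x y : tuples) (u w : vec).

Definition update x (k : 'I_d) w : tuples := fun i => if i == k then w else x i.

Lemma multilinear_update x k w : T (update x k w) = \sum_j w 0 j * T (update x k (e_ j)).
Proof.
have E v : T (update x k v) =
    \sum_(t : d.-tuple 'I_n) S t * (v 0 (tnth t k) * \prod_(i < d | i != k) x i 0 (tnth t i)).
  apply: eq_bigr => t _; rewrite (bigD1 k) //= {1}/update eqxx; congr (_ * (_ * _)).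
  by apply: eq_bigr => i /negbTE ik; rewrite /update ik.
under [RHS]eq_bigr do rewrite E mulr_sumr.
rewrite E exchange_big; apply: eq_bigr => t _ /=.
rewrite (bigD1 (tnth t k)) //= [X in _ + X]big1 ?addr0 => [|j jt].
  by rewrite mxE !eqxx /= mul1r mulrCA.
by rewrite mxE eq_sym (negbTE jt) andbF mul0r !mulr0.
Qed.

Lemma multilinear_updateD x k w w' :
  T (update x k (w + w')) = T (update x k w) + T (update x k w').
Proof.
rewrite !(multilinear_update x k) -big_split; apply: eq_bigr => j _.
by rewrite mxE mulrDl.
Qed.

Lemma multilinear_updateZ x k c w : T (update x k (c *: w)) = c * T (update x k w).
Proof.
rewrite !(multilinear_update x k) mulr_sumr; apply: eq_bigr => j _.
by rewrite mxE mulrA.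
Qed.

Lemma update_same x k : update x k (x k) = x.
Proof. by apply/funext => i; rewrite /update; case: eqP => [->|]. Qed.

Lemma update_comm x i j w w' : i != j ->
  update (update x i w) j w' = update (update x j w') i w.
Proof.
move=> ij; apply/funext => k; rewrite /update; case: (eqVneq k j) => [->|//].
by rewrite eq_sym (negbTE ij).
Qed.

Lemma multilinear_perm x (s : 'S_d) : T (fun k => x (s k)) = T x.
Proof.
rewrite /multilinear_form.
pose h (t : d.-tuple 'I_n) : d.-tuple 'I_n := [tuple tnth t (s k) | k < d].
pose h' (t : d.-tuple 'I_n) : d.-tuple 'I_n := [tuple tnth t ((s^-1)%g k) | k < d].
rewrite (reindex_onto h h') => [|t _]; last first.
  by apply: eq_from_tnth => k; rewrite !tnth_mktuple permK.
apply: eq_big => [t|t _].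
  by apply/eqP; apply: eq_from_tnth => k; rewrite !tnth_mktuple permKV.
have [_ ->] := symS; congr (_ * _); rewrite [RHS](reindex_inj (@perm_inj _ s)).
by apply: eq_bigr => k _; rewrite tnth_mktuple.
Qed.

Lemma multilinear_swap x i j w w' : i != j ->
  T (update (update x i w) j w') = T (update (update x i w') j w).
Proof.
move=> ij; rewrite -(multilinear_perm _ (tperm i j)); congr T; apply/funext => k.
rewrite /update; case: tpermP => [->|->|/eqP ki /eqP kj].
- by rewrite (negbTE ij) !eqxx.
- by rewrite (negbTE ij) !eqxx.
- by rewrite (negbTE ki) (negbTE kj).
Qed.

Definition unit_tuple x := forall k, kvec K (x k) /\ hdot (x k) (x k) = 1.

Lemma unit_tuple_update x k w : unit_tuple x -> kvec K w -> hdot w w = 1 ->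
  unit_tuple (update x k w).
Proof. by move=> ux kw w1 i; rewrite /update; case: eqP. Qed.

Lemma multilinear_scalars x : (forall k, kvec K (x k)) -> T x \in scalars K.
Proof.
move=> kx; apply: scalars_sum => t; apply: scalarsM; first by case: symS.
by apply: scalars_prod => k; exact: ((kvecP K (x k)).1 (kx k)).
Qed.

(** With the other slots frozen, the form in slot [k] attains its norm at [x k], so the equality
    case of Cauchy-Schwarz determines it. *)
Lemma multilinear_maximizer x : unit_tuple x ->
  (forall y, unit_tuple y -> `|T y| <= `|T x|) ->
  forall k w, T (update x k w) = T x * hdot w (x k).
Proof.
move=> ux mx k w; pose v : vec := \row_j T (update x k (e_ j)).
have vE u : \sum_j u 0 j * v 0 j = T (update x k u).
  by rewrite multilinear_update; apply: eq_bigr => j _; rewrite mxE.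
have kv : kvec K v.
  apply/kvecP => j; rewrite mxE; apply: multilinear_scalars => i.
  by rewrite /update; case: eqP => _; [exact: kvec_delta|case: (ux i)].
have h := @norm_attained _ _ K v (x k) (T x) kv (ux k).2 _ _.
rewrite -vE mulr_sumr; apply: eq_bigr => j _; rewrite h.
- by rewrite mulrCA.
- by move=> u ku u1; rewrite vE; apply: mx; exact: unit_tuple_update.
- by rewrite vE update_same.
Qed.

Lemma continuous_multilinear : continuous_form (fun x : tuples => T x).
Proof.
apply: continuous_form_sum => t; apply: continuous_formM; first exact: continuous_form_const.
by apply: continuous_form_prod => k; exact: continuous_form_coord.
Qed.

Lemma continuous_hdot k u : continuous_form (fun x : tuples => hdot (x k) u).
Proof.
apply: continuous_form_sum => j; apply: continuous_formM; first exact: continuous_form_coord.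
exact: continuous_form_const.
Qed.

Lemma closed_unit_tuple : closed_condition unit_tuple.
Proof.
apply: closed_condition_forall => k; apply: closed_condition_and; last first.
  apply: closed_condition_eq; apply: continuous_form_sum => j.
  apply: continuous_formM; first exact: continuous_form_coord.
  exact/continuous_formJ/continuous_form_coord.
rewrite (_ : (fun x => kvec K (x k)) = (fun x => forall j, x k 0 j \in scalars K)).
  apply: closed_condition_forall => j; case: K => /=; last first.
    rewrite (_ : (fun _ => _) = (fun=> (0 : C) = 0)); last by apply/funext => x;
      apply/propext; split.
    by apply: closed_condition_eq; exact: continuous_form_const.
  (* Being real is written as the closed equation that the conjugate minus the coordinate is 0. *)
  rewrite (_ : (fun _ => _) = (fun x : tuples => (x k 0 j)^* + (- 1) * x k 0 j = 0)).
    apply: closed_condition_eq; apply: continuous_formD.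
      exact/continuous_formJ/continuous_form_coord.
    by apply: continuous_formM; [exact: continuous_form_const|exact: continuous_form_coord].
  apply/funext => x; apply/propext; rewrite mulN1r unfold_in /= CrealE -subr_eq0.
  by split=> /eqP.
by apply/funext => x; apply/propext; exact: kvecP.
Qed.

Lemma unit_tuple_bounded x : unit_tuple x ->
  forall k j, `|complex.Re (x k 0 j)| <= 1 /\ `|complex.Im (x k 0 j)| <= 1.
Proof.
move=> ux k j; have : `|x k 0 j| ^+ 2 <= 1.
  have [_ <-] := ux k; rewrite /hdot (bigD1 j) //= normCK lerDl.
  by apply: sumr_ge0 => i _; rewrite -normCK exprn_ge0.
rewrite -add_Re2_Im2 lecE /= eqxx /= => h.
have [h1 h2] : (complex.Re (x k 0 j)) ^+ 2 <= 1 ^+ 2 /\ (complex.Im (x k 0 j)) ^+ 2 <= 1 ^+ 2.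
  by rewrite expr1n; split; apply: le_trans h; rewrite ?lerDl ?lerDr sqr_ge0.
by split; rewrite -ler_sqr ?nnegrE // real_normK // num_real.
Qed.

Lemma multilinear_attained : (exists x, unit_tuple x) ->
  exists2 x, unit_tuple x & forall y, unit_tuple y -> `|T y| <= `|T x|.
Proof.
move=> ex; have cG : continuous_form (fun x : tuples => T x * (T x)^*).
  by apply: continuous_formM; [|apply: continuous_formJ]; exact: continuous_multilinear.
have [x ux mx] := exists_max closed_unit_tuple cG ex unit_tuple_bounded.
exists x => // y /mx; rewrite -!normCK => h.
rewrite -ler_sqr ?nnegrE // lecE h andbT.
by rewrite !(ger0_Im (exprn_ge0 _ (normr_ge0 _))).
Qed.

Lemma hdot_phase u w : kvec K u -> kvec K w -> exists c,
  [/\ c \in scalars K, `|c| = 1 & 0 <= hdot (c *: w) u].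
Proof.
move=> ku kw; have [h0|h0] := eqVneq (hdot w u) 0.
  exists 1; rewrite normr1 hdotZl h0 mulr0 lexx; split=> //.
  exact/scalars_real/real1.
exists ((hdot w u)^* / `|hdot w u|); split.
- apply: scalarsM; last by apply: scalars_real; rewrite realV normr_real.
  apply: scalarsJ; apply: scalars_sum => j; apply: scalarsM; first exact: ((kvecP K w).1 kw).
  by apply: scalarsJ; exact: ((kvecP K u).1 ku).
- by rewrite normrM normfV norm_conjC normr_id divff // normr_eq0.
- rewrite hdotZl mulrAC [_^* * _]mulrC -normCK; apply: mulr_ge0.
    exact: exprn_ge0.
  by rewrite invr_ge0.
Qed.

(** Unit factors in the slots leave the absolute value of [T] unchanged and can make every product
    with [u] nonnegative; over the reals these factors are signs. *)
Lemma rephase x u : unit_tuple x -> kvec K u ->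
  exists y, [/\ unit_tuple y, `|T y| = `|T x|, forall k, 0 <= hdot (y k) u &
    forall k, exists2 c, `|c| = 1 & y k = c *: x k].
Proof.
move=> ux ku; have [c hc] := choice (fun k => hdot_phase ku (ux k).1).
have c1 k : `|c k| = 1 by case: (hc k).
exists (fun k => c k *: x k); split.
- move=> k; have [ck _ _] := hc k; have [kx x1] := ux k; split; first exact: kvecZ.
  by rewrite hdotZl hdotZr x1 mulr1 -normCK c1 expr1n.
- have -> : T (fun k => c k *: x k) = (\prod_k c k) * T x.
    rewrite /multilinear_form mulr_sumr; apply: eq_bigr => t _.
    rewrite mulrCA -big_split; congr (_ * _).
    by apply: eq_bigr => k _; rewrite mxE.
  by rewrite normrM normr_prod big1 ?mul1r.
- by move=> k; case: (hc k).
- by move=> k; exists (c k).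
Qed.

(** [z] is the normalized sum [s] of the two entries. By symmetry the form in the slots [i], [j]
    pairs [s] with [w] to [T x] times [hdot w s], so its value at [z] is [T x]. As the entries
    differ, [s] has norm below 2, and normalizing makes twice its product with [u] exceed the old
    sum. *)
Lemma maximizer_pair x i j u : i != j -> unit_tuple x ->
  (forall y, unit_tuple y -> `|T y| <= `|T x|) -> x i != x j ->
  0 < hdot (x i) u -> 0 <= hdot (x j) u ->
  exists z, [/\ kvec K z, hdot z z = 1, T (update (update x i z) j z) = T x,
    0 <= hdot z u & hdot (x i) u + hdot (x j) u < hdot z u *+ 2].
Proof.
move=> ij ux mx xij iu ju.
have [kxi xi1] := ux i; have [kxj xj1] := ux j.
pose s := x i + x j; pose lam := T x.
have su : 0 < hdot s u by rewrite hdotDl ltr_pwDl.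
have s0 : s != 0 by apply: contraTneq su => ->; rewrite /hdot big1 ?ltxx // => k _;
  rewrite mxE mul0r.
have ss_gt0 := hdot_gt0 s0.
have ss_lt4 : hdot s s < 2 ^+ 2.
  have dd : 0 < hdot (x i - x j) (x i - x j) by apply: hdot_gt0; rewrite subr_eq0.
  have E := hdot_parallelogram (x i) (x j); rewrite xi1 xj1 in E.
  have -> : 2 ^+ 2 = (1 + 1) *+ 2 :> C by ring.
  by rewrite -E ltrDl.
pose N := sqrtC (hdot s s).
have N0 : 0 < N by rewrite sqrtC_gt0.
have NR : N^-1 \is Num.real by rewrite realV gtr0_real.
have N2 : N < 2.
  by rewrite -ltr_sqr ?nnegrE ?ler0n ?ltW // sqrtCK.
pose z := N^-1 *: s.
have B1 w : T (update (update x i (x i)) j w) = lam * hdot w (x j).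
  by rewrite update_same; exact: multilinear_maximizer.
have B2 w : T (update (update x i (x j)) j w) = lam * hdot w (x i).
  rewrite multilinear_swap // update_comm // update_same.
  exact: multilinear_maximizer.
exists z; split.
- by apply: kvecZ; [exact: scalars_real|exact: kvecD].
- exact: unit_normalized.
- have Bs w : T (update (update x i s) j w) = lam * hdot w s.
    rewrite update_comm // multilinear_updateD -!(update_comm _ _ _ ij).
    by rewrite B1 B2 -mulrDr hdotDr addrC.
  rewrite update_comm // multilinear_updateZ -(update_comm _ _ _ ij) Bs hdotZl.
  rewrite -[hdot s s]sqrtCK -/N expr2 /lam; field; by rewrite gt_eqF.
- by rewrite hdotZl mulr_ge0 ?invr_ge0 ?(ltW N0) ?(ltW su).
- rewrite -hdotDl -/s hdotZl -mulr_natl mulrA ltr_pMl //.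
  by rewrite ltr_pdivlMr // mul1r.
Qed.

(* Banach's theorem: among the maximizers whose inner products with a fixed vector u are
   nonnegative, one with the largest sum of these products has equal entries, since two
   different entries could be replaced by their normalized sum. *)
Lemma diagonal_maximizer : (0 < d)%N -> (exists x, unit_tuple x) ->
  exists z, [/\ kvec K z, hdot z z = 1 & forall y, unit_tuple y -> `|T y| <= `|T (fun=> z)|].
Proof.
move=> d0 /multilinear_attained[x0 ux0 mx0]; pose k0 := Ordinal d0.
(* Taking [u] among the entries of [x0] gives the rephased tuple a nonzero product with [u] at [k0],
   so the largest sum is positive. *)
pose u := x0 k0; have [ku u1] := ux0 k0.
have [x1 [ux1 Tx1 hx1 px1]] := rephase ux0 ku.
pose Q x := [/\ unit_tuple x, T x * (T x)^* = T x0 * (T x0)^* & forall k, 0 <= hdot (x k) u].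
pose G x := \sum_k hdot (x k) u.
have cQ : closed_condition Q.
  rewrite (_ : Q = fun x =>
    unit_tuple x /\ (T x * (T x)^* = T x0 * (T x0)^* /\ forall k, 0 <= hdot (x k) u)).
    apply: closed_condition_and; first exact: closed_unit_tuple.
    apply: closed_condition_and.
      apply: closed_condition_eq.
      by apply: continuous_formM; [|apply: continuous_formJ]; exact: continuous_multilinear.
    by apply: closed_condition_forall => k; apply: closed_condition_ge0; exact: continuous_hdot.
  by apply/funext => x; apply/propext; split=> [[]|[? []]].
have cG : continuous_form G by apply: continuous_form_sum => k; exact: continuous_hdot.
have Q1 : Q x1 by split=> //; rewrite -!normCK Tx1.
have bQ x : Q x -> forall k j, `|complex.Re (x k 0 j)| <= 1 /\ `|complex.Im (x k 0 j)| <= 1.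
  by case=> ux _ _; exact: unit_tuple_bounded.
have [x [ux Tx hx] mx] := exists_max cQ cG (ex_intro _ _ Q1) bQ.
(* On [Q] the sums are nonnegative, so the comparison of real parts from [exists_max] is one of the
   sums themselves. *)
have G0 y : Q y -> 0 <= G y by case=> _ _ hy; exact: sumr_ge0.
have {}mx y : Q y -> G y <= G x.
  move=> Qy; rewrite lecE (mx y Qy) andbT.
  by rewrite (ger0_Im (G0 _ Qy)) ger0_Im // G0.
have {}Tx : `|T x| = `|T x0|.
  by apply/eqP; rewrite -(eqrXn2 (n := 2)) // !normCK Tx.
have max_x y : unit_tuple y -> `|T y| <= `|T x| by rewrite Tx; exact: mx0.
have Gx : 0 < G x.
  apply: lt_le_trans (mx _ Q1); have [c c1 E] := px1 k0.
  rewrite /G (bigD1 k0) //= ltr_pwDl //; last exact: sumr_ge0.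
  rewrite lt0r hx1 andbT E hdotZl u1 mulr1 -normr_eq0 c1; exact: oner_neq0.
(* One strictly positive product is what keeps [x i + x j] away from 0 in [maximizer_pair]. *)
have [i iu] : exists i, 0 < hdot (x i) u.
  apply: contrapT => h; move: Gx; rewrite /G big1 ?ltxx // => i _.
  by apply/le_anti; rewrite hx andbT real_leNgt ?real0 ?ger0_real //; apply/negP => h';
    apply: h; exists i.
have xE j : x j = x i.
  apply/eqP/contraT => xji; have ij : i != j by apply: contraNneq xji => ->.
  have [|z [kz z1 Tz zu lt_z]] := maximizer_pair ij ux max_x _ iu (hx j).
    by rewrite eq_sym.
  have Qy : Q (update (update x i z) j z).
    split.
    - by do 2 apply: unit_tuple_update => //.
    - by rewrite Tz -!normCK Tx.
    - by move=> k; rewrite /update; case: eqP => // _; case: eqP.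
  have := mx _ Qy; rewrite /G (bigD1 i) //= (bigD1 j) 1?eq_sym //=.
  rewrite [X in _ <= X](bigD1 i) //= [X in _ <= _ + X](bigD1 j) 1?eq_sym //=.
  have Ei : update (update x i z) j z i = z by rewrite /update (negbTE ij) eqxx.
  have Ej : update (update x i z) j z j = z by rewrite /update eqxx.
  rewrite Ei Ej !addrA.
  rewrite (eq_bigr (fun k => hdot (x k) u)); last first.
    by move=> k /andP[ki kj]; rewrite /update (negbTE ki) (negbTE kj).
  by rewrite lerD2r -mulr2n => /(lt_le_trans lt_z); rewrite ltxx.
exists (x i); have [kx x1'] := ux i; split=> // y uy.
suff <- : x = (fun=> x i) by exact: max_x.
by apply/funext => j; exact: xE.
Qed.

End Banach.

(** * Symmetric tensors and their polynomials *)

Section TensorPolynomials.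
Context (R : realType) (d n : nat).
Local Notation C := R[i].
Local Notation vec := 'rV[R[i]]_n.
Local Notation e_ j := (delta_mx 0 j : vec).
Implicit Types (S : tensor R d n) (x y : vec).

Definition contraction_poly S (i : 'I_n) : {mpoly C[n]} :=
  \sum_(t : d.-tuple 'I_n | ohead t == Some i) S t *: \prod_(j <- behead t) 'X_j.

(** Contracting with it is the conjugated map, which shows that H has polynomial coordinates. *)
Definition conj_tensor S : tensor R d n := [ffun t => (S t)^*].

Lemma meval_prod_var (r : seq 'I_n) (v : 'I_n -> C) :
  (\prod_(j <- r) 'X_j : {mpoly C[n]}).@[v] = \prod_(j <- r) v j.
Proof. by rewrite rmorph_prod; apply: eq_bigr => j _; exact: mevalXU. Qed.

Lemma homog_prod_var (r : seq 'I_n) : (\prod_(j <- r) 'X_j : {mpoly C[n]}) \is (size r).-homog.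
Proof.
elim: r => [|j r IH]; first by rewrite big_nil dhomog1.
by rewrite big_cons /= -add1n; apply: dhomogM => //; rewrite dhomogX; apply/eqP/mdeg1.
Qed.

Lemma homog_contraction_poly S i : contraction_poly S i \is (d.-1).-homog.
Proof.
apply: rpred_sum => t _; apply: dhomogZ.
by have := homog_prod_var (behead t); rewrite size_behead size_tuple.
Qed.

Lemma meval_contraction_poly S i x :
  (contraction_poly S i).@[x 0] = contract_all_but_one S x 0 i.
Proof.
rewrite mxE raddf_sum; apply: eq_bigr => t _ /=.
by rewrite mevalZ meval_prod_var.
Qed.

Lemma meval_tensor_poly S x : (tensor_poly S).@[x 0] = multilinear_form S (fun=> x).
Proof.
rewrite raddf_sum; apply: eq_bigr => t _ /=.
by rewrite mevalZ meval_prod_var big_tuple.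
Qed.

Lemma multilinear_scale S x c :
  multilinear_form S (fun=> c *: x) = c ^+ d * multilinear_form S (fun=> x).
Proof.
rewrite /multilinear_form mulr_sumr; apply: eq_bigr => t _.
under eq_bigr do rewrite mxE.
by rewrite big_split prodr_const card_ord /= mulrCA.
Qed.

Lemma conj_map_contract S y :
  conj_map (contract_all_but_one S) y = contract_all_but_one (conj_tensor S) y.
Proof.
apply/rowP => i; rewrite !mxE rmorph_sum; apply: eq_bigr => t _ /=.
rewrite rmorphM rmorph_prod ffunE; congr (_ * _); apply: eq_bigr => j _ /=.
by rewrite mxE conjCK.
Qed.

Lemma contract_scale S x c :
  contract_all_but_one S (c *: x) = c ^+ d.-1 *: contract_all_but_one S x.
Proof.
apply/rowP => i; rewrite !mxE mulr_sumr; apply: eq_bigr => t _.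
under eq_bigr do rewrite mxE.
by rewrite big_split big_const_seq count_predT size_behead size_tuple iter_mulr_1 /= mulrCA.
Qed.

Lemma mderiv_prod (A : eqType) (r : seq A) (p : A -> {mpoly C[n]}) i : uniq r ->
  (\prod_(k <- r) p k)^`M(i) = \sum_(k <- r) (p k)^`M(i) * \prod_(l <- r | l != k) p l.
Proof.
elim: r => [|a r IH] /=; first by rewrite !big_nil -mpolyC1 mderivC.
case/andP=> ar ur; rewrite !big_cons mderivM IH // eqxx /=; congr (_ * _ + _).
  rewrite big_seq [RHS]big_seq_cond; apply: eq_bigl => l.
  by case: (boolP (l \in r)) => //= lr; apply/esym; apply: contraNneq ar => <-.
rewrite mulr_sumr; apply: eq_big_seq => k kr.
have ak : a != k by apply: contraNneq ar => ->.
by rewrite big_cons ak mulrCA.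
Qed.

End TensorPolynomials.

(** * The scaled gradient as a contraction *)

Section Gradient.
Context (R : realType) (d n : nat) (K : scalar_field) (S : tensor R d.+1 n).
Hypothesis symS : symmetric_tensor K S.
Local Notation C := R[i].
Local Notation vec := 'rV[R[i]]_n.
Local Notation e_ j := (delta_mx 0 j : vec).
Implicit Types (x y : vec).

Lemma contract_update x i :
  contract_all_but_one S x 0 i = multilinear_form S (update (fun=> x) ord0 (e_ i)).
Proof.
rewrite mxE big_mkcond; apply: eq_bigr => t _; case/tupleP: t => h t.
rewrite big_ord_recl /update eqxx mxE eqxx /= tnth0.
case: (eqVneq h i) => [->|hi]; last first.
  by rewrite ifF ?mul0r ?mulr0 //; apply/eqP => -[E]; rewrite E eqxx in hi.
rewrite eqxx mul1r big_tuple; congr (_ * _); apply: eq_bigr => k _.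
by rewrite tnthS.
Qed.

Lemma multilinear_update_const x k i :
  multilinear_form S (update (fun=> x) k (e_ i)) =
  multilinear_form S (update (fun=> x) ord0 (e_ i)).
Proof.
rewrite -[RHS](multilinear_perm symS _ (tperm ord0 k)); congr (multilinear_form S).
apply/funext => l; rewrite /update; case: tpermP => [->|->|/eqP l0 /eqP lk].
- by rewrite eq_sym.
- by rewrite !eqxx.
- by rewrite (negbTE l0) (negbTE lk).
Qed.

(** The product rule yields one term for each slot; by symmetry all equal the term of the first
    slot, and their number cancels the scaling factor. *)
Lemma scaled_gradient_contract x : scaled_gradient S x = contract_all_but_one S x.
Proof.
apply/rowP => i; rewrite contract_update mxE.
suff -> : ((tensor_poly S)^`M(i)).@[x 0] =
    \sum_(k < d.+1) multilinear_form S (update (fun=> x) k (e_ i)).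
  under eq_bigr do rewrite multilinear_update_const.
  by rewrite sumr_const card_ord -[X in _ * X]mulr_natl mulKf // pnatr_eq0.
rewrite /multilinear_form [RHS]exchange_big /tensor_poly (raddf_sum (mderiv i)).
rewrite (raddf_sum (meval (x 0))); apply: eq_bigr => t _ /=.
rewrite mderivZ mevalZ big_tuple mderiv_prod ?index_enum_uniq //.
rewrite raddf_sum -mulr_sumr; congr (_ * _); apply: eq_bigr => k _ /=.
rewrite [RHS](bigD1 k) //= /update eqxx mevalM mxE eqxx /=; congr (_ * _).
  rewrite mderivX mnm1E mevalZ.
  case: (eqVneq (tnth t k) i) => [->|ki]; last by rewrite mul0r.
  rewrite (_ : (U_(i) - U_(i))%MM = 0%MM) ?mpolyX0 ?meval1 ?mulr1 //.
  by apply/mnmP => j; rewrite mnmBE subnn mnm0E.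
rewrite rmorph_prod; apply: eq_bigr => l /negbTE lk.
by rewrite lk /= mevalXU.
Qed.

End Gradient.

(** * Fixed points of one homogeneous map, for use with both F and H *)

Section PolynomialFixpoints.
Context (R : realType) (n D : nat).
Local Notation C := R[i].
Local Notation vec := 'rV[R[i]]_n.
Variables (G : vec -> vec) (h : 'I_n -> {mpoly C[n]}).
Hypothesis GE : forall x, G x = \row_i (h i).@[x 0].
Hypothesis hom_h : forall i, h i \is D.-homog.
Hypothesis D_gt1 : (1 < D)%N.

Lemma zero_fixpoint_multiplicity p k :
  has_zero_multiplicity (fun i => h i - 'X_i) p k -> has_fixpoint_multiplicity G p k.
Proof. by move=> hk; exists h. Qed.

Lemma origin_multiplicity : has_fixpoint_multiplicity G 0 1.
Proof. exact/zero_fixpoint_multiplicity/multiplicity_one_at_origin. Qed.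

Lemma fixpoint_count : (forall x, G x = 0 -> x = 0) -> fix_card_with_multiplicity G (D ^ n).
Proof.
move=> Gz; have zh (v : vec) : (forall i, (h i).@[v 0] = 0) -> v = 0.
  by move=> hv; apply: Gz; apply/rowP => i; rewrite GE !mxE hv.
have [s [mu [us zs hmu smu]]] := zero_multiplicities (bezout_fixpoints D_gt1 hom_h zh).
exists s, mu; split=> // [x|x xs]; last exact/zero_fixpoint_multiplicity/hmu.
rewrite -zs /fix_set /= GE; split=> [/rowP hx i|hx].
  by rewrite mevalB mevalXU -(hx i) mxE subrr.
apply/rowP => i; rewrite mxE; apply/eqP; have := hx i.
by rewrite mevalB mevalXU => /eqP; rewrite subr_eq0.
Qed.

Lemma homogeneous_fix0 : fix_set G 0.
Proof.
apply/rowP => i; rewrite GE !mxE.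
by rewrite (meval0_homog (ltnW D_gt1) (hom_h i)).
Qed.

(** At a fixed point [G (c *: x)] is [c ^+ D *: x], so the condition is [c ^+ D = c] with [c]
    nonzero. *)
Lemma homogeneous_fix_scale x c : (fix_set G `\ 0)%classic x ->
  (fix_set G `\ 0)%classic (c *: x) <-> c ^+ D.-1 = 1.
Proof.
move=> [/= Gx /eqP x0]; have Gc : G (c *: x) = c ^+ D *: x.
  rewrite -[in RHS]Gx !GE; apply/rowP => i; rewrite !mxE.
  rewrite -(meval_homog _ _ (hom_h i)); apply: meval_eq => j.
  by rewrite mxE.
have D0 : (0 < D)%N by exact: ltnW.
have cE : c ^+ D = c * c ^+ D.-1 by rewrite -exprS prednK.
split=> [[/= fx /eqP cx0]|c1].
  have c0 : c != 0 by apply: contraNneq cx0 => ->; rewrite scale0r.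
  move: fx; rewrite /fix_set /= Gc => /eqP;
    rewrite -subr_eq0 -scalerBl scaler_eq0 (negbTE x0) orbF.
  by rewrite cE subr_eq0 -[X in _ == X]mulr1 (inj_eq (mulfI c0)) => /eqP.
split; rewrite /fix_set /= ?Gc ?cE ?c1 ?mulr1 //.
apply/eqP; rewrite scaler_eq0 negb_or x0 andbT; apply: contraTneq (oner_neq0 C) => c0.
by rewrite -c1 c0 expr0n gtn_eqF ?eqxx // -subn1 subn_gt0.
Qed.

End PolynomialFixpoints.

(** * From the maximizer to fixed points; the order of the tensor is now [d.+1] *)

Section SpectralNorm.
Context (R : realType) (d n : nat) (K : scalar_field) (S : tensor R d.+1 n).
Hypotheses (symS : symmetric_tensor K S) (S_neq0 : S != 0) (d_gt1 : (1 < d)%N).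
Local Notation C := R[i].
Local Notation vec := 'rV[R[i]]_n.
Local Notation e_ j := (delta_mx 0 j : vec).
Local Notation T := (multilinear_form S).
Local Notation F := (contract_all_but_one S).
Implicit Types (x y z : vec) (c : C).

Lemma ler_normc (a b : C) : (Normc.normc a <= Normc.normc b) = (`|a| <= `|b|).
Proof. by rewrite !normc_norm lecR. Qed.

Lemma multilinear_delta (t : d.+1.-tuple 'I_n) : T (fun k => e_ (tnth t k)) = S t.
Proof.
rewrite /multilinear_form (bigD1 t) //= big1 => [|k _]; last by rewrite mxE !eqxx.
rewrite mulr1 big1 ?addr0 // => t' tt'; have [k tk] : exists k, tnth t' k != tnth t k.
  apply: contrapT => h; move/negP: tt'; apply; apply/eqP/eq_from_tnth => k.
  by apply: contrapT => /eqP h'; apply: h; exists k.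
by rewrite (bigD1 k) //= mxE (negbTE tk) andbF mul0r mulr0.
Qed.

(** The maximum is positive because nonzero entries of [S] are values at tuples of basis vectors;
    the identity for [F z] is [multilinear_maximizer] evaluated at the basis vectors. *)
Lemma top_singular_vector : exists z, [/\ kvec K z, hdot z z = 1, T (fun=> z) != 0,
  forall y : 'I_d.+1 -> vec, unit_tuple K y -> `|T y| <= `|T (fun=> z)| & F z = T (fun=>
    z) *: conj_vec z].
Proof.
have [t St] : exists t, S t != 0.
  apply: contrapT => h; move/negP: S_neq0; apply; apply/eqP/ffunP => t; rewrite ffunE.
  by apply: contrapT => /eqP h'; apply: h; exists t.
have ut : unit_tuple K (fun k => e_ (tnth t k)).
  by move=> k; split; [exact: kvec_delta|rewrite hdot_delta mxE !eqxx rmorph1].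
have [z [kz z1 mz]] := diagonal_maximizer symS (ltn0Sn d) (ex_intro _ _ ut).
have uz : unit_tuple K (fun _ : 'I_d.+1 => z) by [].
exists z; split=> //.
  by rewrite -normr_gt0; apply: lt_le_trans (mz _ ut); rewrite multilinear_delta normr_gt0.
apply/rowP => i; rewrite contract_update (multilinear_maximizer symS uz mz).
by rewrite hdot_delta !mxE.
Qed.

Lemma hnormZ c x : hnorm (c *: x) = Normc.normc c * hnorm x.
Proof.
have c0 : 0 <= Normc.normc c by rewrite -lecR -normc_norm normr_ge0.
apply/eqP; rewrite -(eqrXn2 (n := 2)) ?mulr_ge0 ?hnorm_ge0 //; apply/eqP/complexI.
rewrite hnorm_hdot exprMn [RHS]rmorphM /= hnorm_hdot [X in X * _]rmorphXn /=.
by rewrite hdotZl hdotZr mulrA -normCK normc_norm.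
Qed.

Lemma normcX c k : Normc.normc (c ^+ k) = Normc.normc c ^+ k.
Proof.
elim: k => [|k IH]; first by rewrite !expr0; exact: Normc.normc1.
by rewrite !exprS Normc.normcM IH.
Qed.

Lemma hnorm_eq0 x : hnorm x = 0 -> x = 0.
Proof. by move=> h; apply: hdot_eq0; rewrite -hnorm_hdot h expr0n. Qed.

Section Maximum.
Variable z : vec.
Hypotheses (kz : kvec K z) (z1 : hdot z z = 1).
Hypothesis max_z : forall y : 'I_d.+1 -> vec, unit_tuple K y -> `|T y| <= `|T (fun=> z)|.
Let m := Normc.normc (T (fun=> z)).

Lemma is_tensor_spectral_norm_max : is_tensor_spectral_norm K S m.
Proof.
split; first by exists (fun=> z) => // k; split=> //; apply/hnorm1P.
move=> _ [y hy <-]; rewrite ler_normc; apply: max_z => k.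
by have [ky /hnorm1P] := hy k.
Qed.

Lemma is_poly_spectral_norm_max : is_poly_spectral_norm K (tensor_poly S) m.
Proof.
split; first by exists z; [split=> //; apply/hnorm1P|rewrite meval_tensor_poly].
move=> _ [y [ky /hnorm1P y1] <-]; rewrite meval_tensor_poly ler_normc.
by apply: max_z => k.
Qed.

(** The ratio is invariant under scaling: it equals [m] at every nonzero multiple of [z], and
    normalizing any other vector of [A] bounds its ratio by [m]. *)
Lemma is_max_ratios (A : set vec) c : c != 0 -> A (c *: z) -> (forall x, A x -> kvec K x) ->
  is_max (ratios d.+1 (tensor_poly S) A) m.
Proof.
move=> c0 Acz Ak; split.
  exists (c *: z).
    split=> //= /eqP; rewrite scaler_eq0 (negbTE c0) /= => /eqP z0.
    by move/eqP: z1; rewrite z0 /hdot big1 ?(eq_sym 0) ?oner_eq0 // => j _; rewrite mxE mul0r.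
  rewrite meval_tensor_poly multilinear_scale Normc.normcM normcX hnormZ.
  have -> : hnorm z = 1 by apply/hnorm1P.
  rewrite mulr1 mulrAC divff ?mul1r //; apply: expf_neq0.
  by apply: contraNneq c0 => /Normc.eq0_normc ->.
move=> _ [x [Ax /= /eqP x0] <-]; have h0 : 0 < hnorm x.
  by rewrite lt0r hnorm_ge0 andbT; apply: contra x0 => /eqP/hnorm_eq0/eqP.
rewrite ler_pdivrMr ?exprn_gt0 //; pose r : C := ((hnorm x)^-1)%:C%C.
have rn : Normc.normc r = (hnorm x)^-1.
  by rewrite /r /= expr0n addr0 sqrtr_sqr ger0_norm // invr_ge0 ltW.
have : Normc.normc (T (fun=> r *: x)) <= m.
  rewrite ler_normc; apply: max_z => _; split.
    apply: kvecZ (Ak _ Ax); apply: scalars_real; apply/complex_realP.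
    by exists (hnorm x)^-1.
  by apply/hnorm1P; rewrite hnormZ rn mulVf // gt_eqF.
rewrite multilinear_scale Normc.normcM normcX rn meval_tensor_poly exprVn.
by rewrite ler_pdivrMl ?exprn_gt0 // mulrC.
Qed.

End Maximum.

Lemma positive_root (a : C) k : a != 0 -> (0 < k)%N ->
  exists r : C, [/\ 0 < r & r ^+ k * `|a| = 1].
Proof.
move=> a0 k0; exists (k.-root `|a|^-1); split.
  by rewrite rootC_gt0 // invr_gt0 normr_gt0.
by rewrite rootCK // mulVf // normr_eq0.
Qed.

Lemma conj_normE c : `|c| = 1 -> c * c^* = 1.
Proof. by move=> c1; rewrite -normCK c1 expr1n. Qed.

(** For a positive [r'] and a [c] of modulus 1, the equation at [(r' * c) *: z] splits into
    [r' ^+ d.-1] times the modulus of [lam] being 1, and [c ^+ d.+1] being the conjugate of [lam]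
    over its modulus. *)
Lemma afix_scaling z : T (fun=> z) != 0 -> F z = T (fun=> z) *: conj_vec z ->
  exists2 c, c != 0 & F (c *: z) = conj_vec (c *: z).
Proof.
set lam := T _ => lam0 Fz.
have d1 : (0 < d.-1)%N by rewrite -subn1 subn_gt0.
have [r' [r'0 r'E]] := positive_root lam0 d1.
pose c := d.+1.-root (lam^* / `|lam|).
have n0 : `|lam| != 0 by rewrite normr_eq0.
have cd : c ^+ d.+1 = lam^* / `|lam| by rewrite rootCK.
have c1 : `|c| = 1.
  apply/eqP; rewrite -(@pexpr_eq1 _ _ d.+1) ?normr_ge0 //.
  by rewrite -normrX cd normrM normfV norm_conjC normr_id divff.
have c0 : c != 0 by rewrite -normr_eq0 c1 oner_neq0.
exists (r' * c); first by rewrite mulf_neq0 // gt_eqF.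
rewrite contract_scale Fz scalerA /conj_vec.
apply/rowP => j; rewrite !mxE rmorphM rmorphM /= (conj_Creal (gtr0_real r'0)).
congr (_ * _).
have E : (r' * c) ^+ d * lam * c = r' * c^* * c.
  have -> : (r' * c) ^+ d * lam * c = r' * (r' ^+ d.-1 * (c ^+ d.+1 * lam)).
    by rewrite exprMn exprSr -{1}(prednK (ltnW d_gt1)) [r' ^+ d.-1.+1]exprS; ring.
  rewrite cd mulrAC [_^* * _]mulrC -normCK expr2 mulfK // r'E mulr1.
  by rewrite -mulrA [_^* * _]mulrC conj_normE // mulr1.
exact: (mulIf c0).
Qed.

End SpectralNorm.

Lemma omega_pow (R : realType) m k : omega R m ^+ k =
  Complex (cos (pi / m%:R *+ k)) (sin (pi / m%:R *+ k)).
Proof.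
elim: k => [|k IH]; first by rewrite expr0 mulr0n cos0 sin0.
rewrite exprSr IH mulrSr cosD sinD /omega.
by apply/eqP; rewrite eq_complex /= addrC [_ * sin _ + _]addrC !eqxx.
Qed.

Lemma omega_root (R : realType) m : (0 < m)%N -> omega R m ^+ m = - 1.
Proof.
move=> m0; rewrite omega_pow -mulr_natr divfK ?pnatr_eq0 -?lt0n // cospi sinpi.
by apply/eqP; rewrite eq_complex /= oppr0 !eqxx.
Qed.

Lemma omega_conj (R : realType) m : (omega R m)^* * omega R m = 1.
Proof.
rewrite /omega; apply/eqP; rewrite eq_complex /= mulNr opprK -!expr2 cos2Dsin2 eqxx /=.
by rewrite mulNr mulrC subrr.
Qed.

Lemma conj_vecK (R : realType) n : involutive (@conj_vec R n).
Proof. by move=> x; apply/rowP => j; rewrite !mxE conjCK. Qed.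

Lemma conj_vec_eq0 (R : realType) n (x : 'rV[R[i]]_n) : conj_vec x = 0 -> x = 0.
Proof. by move=> x0; rewrite -[x]conj_vecK x0; apply/rowP => j; rewrite !mxE rmorph0. Qed.

Lemma fix_scaling (R : realType) d n (S : tensor R d.+1 n) (z : 'rV[R[i]]_n) (lam c : R[i]) :
  (0 < d)%N -> contract_all_but_one S z = lam *: z -> c ^+ d.-1 * lam = 1 ->
  fix_set (contract_all_but_one S) (c *: z).
Proof.
move=> d0 Sz clam; rewrite /fix_set /= contract_scale Sz scalerA /=.
by rewrite -{1}(prednK d0) exprS -mulrA clam mulr1.
Qed.

(** The vector [c *: z] is fixed as soon as [c ^+ d.-1 * lam = 1]. For odd order [d.+1] the exponent
    is odd and [c] can absorb the sign of [lam]; for even order a negative [lam] excludes real [c],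
    and [omega] supplies the factor -1. *)
Lemma real_fix_scaling (R : realType) d n (S : tensor R d.+1 n) (z : 'rV[R[i]]_n) (lam : R[i]) :
  (1 < d)%N -> lam \is Num.real -> lam != 0 -> kvec RealScalars z ->
  contract_all_but_one S z = lam *: conj_vec z ->
  exists2 c, c != 0 & real_fix_set d.+1 (contract_all_but_one S) (c *: z).
Proof.
move=> d_gt1 lamR lam0 kz; have d0 := ltnW d_gt1.
have -> : conj_vec z = z.
  apply/rowP => j; rewrite mxE conj_Creal //.
  exact: ((kvecP RealScalars z).1 kz j).
move=> Sz; have d1 : (0 < d.-1)%N by rewrite -subn1 subn_gt0.
have [r [r0 rE]] := positive_root lam0 d1.
have n0 : `|lam| != 0 by rewrite normr_eq0.
have realZ c : c \is Num.real -> kvec RealScalars (c *: z) by move=> cR; exact: kvecZ.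
rewrite /real_fix_set; case: ifPn => [d_odd|d_even].
  pose s := lam / `|lam|.
  have ss : s * s = 1.
    by rewrite mulf_div -!expr2 normCK (conj_Creal lamR) -expr2 divff // sqrf_eq0.
  have s0 : s != 0 by apply/eqP => s0; move/eqP: ss; rewrite s0 mul0r eq_sym oner_eq0.
  exists (r * s); first by rewrite mulf_neq0 // gt_eqF.
  split; last first.
    apply: realZ; apply: realM; first exact: gtr0_real.
    by apply: realM => //; rewrite realV normr_real.
  apply: fix_scaling Sz _ => //; rewrite exprMn.
  have -> : s ^+ d.-1 = s.
    rewrite -(odd_double_half d.-1) -mul2n exprD exprM [s ^+ 2]ss expr1n mulr1.
    suff -> : odd d.-1 by rewrite expr1.
    by move: d_odd; rewrite -{1}(prednK d0) /= negbK.
  rewrite -mulrA; have -> : s * lam = `|lam|.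
    by rewrite /s mulrAC -{2}(conj_Creal lamR) -normCK expr2 mulfK.
  by [].
exists r; first by rewrite gt_eqF.
split; last exact/realZ/gtr0_real.
have := lamR; rewrite realE => /orP[lam_ge0|lam_le0].
  by left; apply: fix_scaling Sz _ => //; rewrite -{1}(ger0_norm lam_ge0).
(* The fixed point is not real, but its product with the conjugate of [omega] is the real vector
   [r *: z]. *)
right; exists ((omega R (d.+1 - 2) * r) *: z).
  apply: fix_scaling Sz _ => //; rewrite exprMn subSS subn1 omega_root //.
  by rewrite mulN1r mulNr -mulrN -(ler0_norm lam_le0).
by rewrite scalerA mulrA omega_conj mul1r.
Qed.

Local Open Scope classical_set_scope.
Local Open Scope ring_scope.

Theorem theorem7 (R : realType) (K : scalar_field) (n d : nat)
    (S : tensor R d n) (hd : (3 <= d)%N)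
    (hS : symmetric_tensor K S) (hS0 : S != 0) :
  let f := tensor_poly S in
  let F := scaled_gradient S in
  let Fbar := conj_map F in
  let H := Fbar \o F in
  [/\ K = RealScalars ->
        exists m : R,
          [/\ is_tensor_spectral_norm RealScalars S m,
              is_poly_spectral_norm RealScalars f m &
              is_max (ratios d f (real_fix_set d F)) m],
      K = ComplexScalars ->
        [/\ afix_set F `<=` fix_set H,
            forall x : 'rV[R[i]]_n,
              fix_set H x <->
              exists y : 'rV[R[i]]_n, F x - y = 0 /\ Fbar y - x = 0 &
            exists m : R,
              [/\ is_tensor_spectral_norm ComplexScalars S m,
                  is_poly_spectral_norm ComplexScalars f m &
                  is_max (ratios d f (fix_set H)) m]] &
      nonsingular_tensor S ->
        [/\ fix_card_with_multiplicity F ((d - 1) ^ n),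
            fix_card_with_multiplicity H ((d - 1) ^ (2 * n)),
            [/\ fix_set F 0, has_fixpoint_multiplicity F 0 1,
                fix_set H 0 & has_fixpoint_multiplicity H 0 1],
            forall (x : 'rV[R[i]]_n) (phi : R[i]), (fix_set F `\ 0) x ->
              (fix_set F `\ 0) (phi *: x) <-> phi ^+ (d - 2) = 1 &
            forall (y : 'rV[R[i]]_n) (psi : R[i]), (fix_set H `\ 0) y ->
              (fix_set H `\ 0) (psi *: y) <->
              psi ^+ ((d - 1) ^ 2 - 1) = 1]].
Proof.
case: d S hd hS hS0 => [//|d] S; rewrite ltnS => d_gt1 hS hS0 f F Fbar H.
have FE : F = contract_all_but_one S by apply/funext => x; exact: scaled_gradient_contract hS x.
have afix_fix : (afix_set F `<=` fix_set H)%classic.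
  by move=> x Fx; rewrite /fix_set /H /= /Fbar /conj_map Fx conj_vecK Fx conj_vecK.
split.
- move=> KE; subst K.
  have [z [kz z1 lam0 mz Fz]] := top_singular_vector hS hS0.
  have lamR : multilinear_form S (fun=> z) \is Num.real.
    exact: (multilinear_scalars hS).
  have [c c0 cA] := real_fix_scaling d_gt1 lamR lam0 kz Fz.
  exists (Normc.normc (multilinear_form S (fun=> z))); split.
  + exact: is_tensor_spectral_norm_max.
  + exact: is_poly_spectral_norm_max.
  + rewrite FE; apply: (is_max_ratios z1 mz c0 cA) => x; by case.
- move=> KE; subst K; split=> //.
    move=> x; split=> [Hx|[y [/eqP Fx /eqP Fy]]].
      by exists (F x); rewrite subrr; split=> //; apply/eqP; rewrite subr_eq0; apply/eqP.
    rewrite subr_eq0 in Fx; rewrite subr_eq0 in Fy.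
    by rewrite /fix_set /H /= (eqP Fx) (eqP Fy).
  have [z [kz z1 lam0 mz Fz]] := top_singular_vector hS hS0.
  have [c c0 cA] := afix_scaling d_gt1 lam0 Fz.
  exists (Normc.normc (multilinear_form S (fun=> z))); split.
  + exact: is_tensor_spectral_norm_max.
  + exact: is_poly_spectral_norm_max.
  + apply: (is_max_ratios z1 mz c0); first by apply: afix_fix; rewrite /afix_set /= FE.
    by move=> x _; apply/kvecP.
- move=> nonsing.
  have FP x : F x = \row_i (contraction_poly S i).@[x 0].
    by rewrite FE; apply/rowP => i; rewrite [RHS]mxE meval_contraction_poly.
  have Fhom i : contraction_poly S i \is d.-homog := homog_contraction_poly S i.
  have Fzero x : F x = 0 -> x = 0 by rewrite FE; exact: nonsing.
  (* H is contraction by the conjugate tensor after contraction by [S], hence homogeneous of degree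
     [d * d]. *)
  pose h i := subst (contraction_poly S) (contraction_poly (conj_tensor S) i).
  have HP x : H x = \row_i (h i).@[x 0].
    rewrite /H /= /Fbar FE conj_map_contract; apply/rowP => i; rewrite [RHS]mxE.
    rewrite -meval_contraction_poly meval_subst; apply: meval_eq => j.
    by rewrite meval_contraction_poly.
  have Hhom i : h i \is (d * d).-homog by apply: homog_subst => //;
    exact: homog_contraction_poly.
  have Hzero x : H x = 0 -> x = 0.
    by move/conj_vec_eq0/Fzero/conj_vec_eq0/Fzero.
  have dd_gt1 : (1 < d * d)%N by exact: leq_trans d_gt1 (leq_pmulr _ (ltnW d_gt1)).
  rewrite subn1 expnM /= -mulnn; split.
  + exact: fixpoint_count FP Fhom d_gt1 Fzero.
  + exact: fixpoint_count HP Hhom dd_gt1 Hzero.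
  + split; [exact: homogeneous_fix0 FP Fhom d_gt1|exact: origin_multiplicity FP Fhom d_gt1|
      exact: homogeneous_fix0 HP Hhom dd_gt1|exact: origin_multiplicity HP Hhom dd_gt1].
  + by move=> x phi hx; rewrite subSS subn1; exact: homogeneous_fix_scale FP Fhom d_gt1 _ _ hx.
  + by move=> y psi hy; rewrite subn1; exact: homogeneous_fix_scale HP Hhom dd_gt1 _ _ hy.
Qed.
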